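(* Let $K$ be a field. Then the subgroup $\mathrm{LGL}_2(K)$ of $L_K(R_2)^\times$ generated by all elements $u(A,M,B)$ (where $A,B$ are ordered binary leaf sets of the same cardinality $n$ and $M\in\mathrm{GL}_n(K)$, with $n\ge1$ arbitrary) is the full unit group: $$\mathrm{LGL}_2(K)=L_K(R_2)^\times .$$
   Context: $L=L_K(R_2)$ is the unital associative $K$-algebra generated by $e,f,e^*,f^*$ subject to $e^*e=f^*f=1$, $e^*f=f^*e=0$, $ee^*+ff^*=1$. A word $\alpha=x_1\cdots x_r$ in the free monoid $\{e,f\}^*$ (with empty word $1$) is viewed as an element of $L$, and $\alpha^*=x_r^*\cdots x_1^*$, $1^*=1$. The rooted binary tree has vertex set $\{e,f\}^*$, root $1$, and $\gamma$ has children $\gamma e,\gamma f$. A finite rooted subtree is full if it contains the root, is closed under prefixes, and each of its vertices has either both children or no child in it. A leaf set is the set of leaves of such a finite full subtree; equivalently, it is obtained from $\{1\}$ by finitely many simple expansions, each replacing an element $\gamma$ by $\gamma e,\gamma f$. An ordered leaf set is an ordering $(\gamma_1,\ldots,\gamma_n)$ of a leaf set. For ordered leaf sets $A=(\alpha_1,\ldots,\alpha_n)$, $B=(\beta_1,\ldots,\beta_n)$ and $M=(m_{ij})\in\mathrm{GL}_n(K)$, put $u(A,M,B)=\sum_{i,j=1}^n m_{ij}\alpha_i\beta_j^*$; this is a unit of $L$ with inverse $u(B,M^{-1},A)$. For a ring $R$, $R^\times$ denotes its unit group. *)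

(* Defs.v *)
From HB Require Import structures.
From mathcomp Require Import all_boot all_order all_algebra.
From mathcomp Require Import finmap boolp.
From mathcomp.multinomials Require Import monalg.

Set Implicit Arguments.
Unset Strict Implicit.
Unset Printing Implicit Defensive.

Import GRing.Theory.
Local Open Scope ring_scope.
Local Open Scope quotient_scope.

(* The letter e is [false] and the letter f is [true]. *)
Notation letter := bool (only parsing).
Notation word := (seq letter) (only parsing).

(* The generators of the Leavitt algebra: [inl x] is the letter x and
   [inr x] is the formal symbol x^*. *)
Notation generator := (letter + letter)%type (only parsing).

Notation free_algebra K := {malg K[{fmonom generator}]}.

Section LeavittIdeal.
Variable K : fieldType.
Local Notation F := (free_algebra K).

Definition free_gen (g : generator) : F := << fmu g >>.

Definition leavitt_relators : seq F :=
  let e := free_gen (inl false) in let es := free_gen (inr false) in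
  let f := free_gen (inl true) in let fs := free_gen (inr true) in
  [:: es * e - 1; fs * f - 1; es * f; fs * e; e * es + f * fs - 1].

(* The two-sided ideal generated by the relators (closure under opposites
   follows from multiplication by -1). *)
Inductive leavitt_ideal : F -> Prop :=
| leavitt_ideal_relator r : r \in leavitt_relators -> leavitt_ideal r
| leavitt_ideal0 : leavitt_ideal 0
| leavitt_idealD a b : leavitt_ideal a -> leavitt_ideal b -> leavitt_ideal (a + b)
| leavitt_idealMl a b : leavitt_ideal b -> leavitt_ideal (a * b)
| leavitt_idealMr a b : leavitt_ideal a -> leavitt_ideal (a * b).

Definition leavitt_idealb (a : F) : bool := `[< leavitt_ideal a >].

Fact leavitt_ideal_zmod_closed : zmod_closed leavitt_idealb.
Proof.
split=> [|a b /asboolP Ia /asboolP Ib]; first exact/asboolP/leavitt_ideal0.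
apply/asboolP/leavitt_idealD => //; rewrite -mulN1r.
exact: leavitt_idealMl.
Qed.

HB.instance Definition _ :=
  GRing.isZmodClosed.Build F leavitt_idealb leavitt_ideal_zmod_closed.

Definition leavitt :=
  Quotient.quot (GRing.ZmodClosed.clone F leavitt_idealb _).

HB.instance Definition _ := GRing.Zmodule.on leavitt.
HB.instance Definition _ := ZmodQuotient.on leavitt.

End LeavittIdeal.

(* The five relations hold for operators on functions [nat -> K]; this action
   shows that 1 is not in the ideal. *)
Section NonTrivial.
Variable K : fieldType.
Local Notation F := (free_algebra K).

Definition gen_act (g : generator) (v : nat -> K) : nat -> K := fun n =>
  match g with
  | inl x => if odd n == x then v n./2 else 0
  | inr x => v (x + n.*2)%N
  end.

Definition mon_act (m : {fmonom generator}) (v : nat -> K) : nat -> K :=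
  foldr gen_act v m.

Definition free_act (a : F) (v : nat -> K) (n : nat) : K :=
  mmap idfun (fun m => mon_act m v n) a.

Let gen_act_eq g v w : v =1 w -> gen_act g v =1 gen_act g w.
Proof. by case: g => x vw n /=; rewrite !vw. Qed.

Let mon_act_eq m v w : v =1 w -> mon_act m v =1 mon_act m w.
Proof. by case: m => s vw; elim: s => [|g s IH] //=; exact: gen_act_eq. Qed.

Let free_act_eq a v w : v =1 w -> free_act a v =1 free_act a w.
Proof. by move=> vw n; apply: eq_bigr => m _; rewrite (mon_act_eq _ vw). Qed.

Let free_actU c m v n : free_act << c *g m >> v n = c * mon_act m v n.
Proof. exact: mmapU. Qed.

Let free_actD a b v n : free_act (a + b) v n = free_act a v n + free_act b v n.
Proof. exact: mmapD. Qed.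

Let free_act0 v n : free_act 0 v n = 0.
Proof. exact: mmap0. Qed.

Let free_act_sum T (r : seq T) (E : T -> F) v n :
  free_act (\sum_(i <- r) E i) v n = \sum_(i <- r) free_act (E i) v n.
Proof. by elim/big_rec2: _ => [|i y x _ <-]; rewrite ?free_act0 ?free_actD. Qed.

Let gen_act_lin T (r : seq T) (c : T -> K) (w : T -> nat -> K) g n :
  gen_act g (fun n => \sum_(i <- r) c i * w i n) n
    = \sum_(i <- r) c i * gen_act g (w i) n.
Proof.
case: g => x //=; case: eqP => // _.
by rewrite big1 // => i _; rewrite mulr0.
Qed.

Let mon_act_lin T (r : seq T) (c : T -> K) (w : T -> nat -> K) m n :
  mon_act m (fun n => \sum_(i <- r) c i * w i n) n
    = \sum_(i <- r) c i * mon_act m (w i) n.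
Proof.
case: m => s; elim: s n => [|g s IH] n //=.
by rewrite -gen_act_lin; apply: gen_act_eq => k; exact: IH.
Qed.

Let mon_actM (m1 m2 : {fmonom generator}) v :
  mon_act (mmul m1 m2) v = mon_act m1 (mon_act m2 v).
Proof. by rewrite /mon_act fmM foldr_cat. Qed.

Let free_actM a b v n : free_act (a * b) v n = free_act a (free_act b v) n.
Proof.
rewrite malgME free_act_sum; apply: eq_bigr => m1 _.
rewrite free_act_sum.
have := mon_act_lin (msupp b) (fun m => b@_m) (fun m => mon_act m v) m1 n.
rewrite /= => ->; rewrite mulr_sumr.
by apply: eq_bigr => m2 _; rewrite free_actU mon_actM mulrA.
Qed.

Let free_act1 v n : free_act 1 v n = v n.
Proof. by rewrite -mpolyC1E (free_actU 1 mone v n) mul1r /mon_act fm1. Qed.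

Let free_actN a v n : free_act (- a) v n = - free_act a v n.
Proof. exact: mmapN. Qed.

Let free_act_gen g v n : free_act (free_gen K g) v n = gen_act g v n.
Proof. by rewrite (free_actU 1 (fmu g) v n) mul1r /mon_act fmU. Qed.

Let free_act_ideal (a : F) : leavitt_ideal a -> forall v n, free_act a v n = 0.
Proof.
elim=> {a} [r|v n|a b _ Ia _ Ib v n|a b _ Ib v n|a b _ Ia v n].
- have gen2 g h v n : free_act (free_gen K g * free_gen K h) v n
      = gen_act g (gen_act h v) n.
    by rewrite free_actM free_act_gen; apply: gen_act_eq => k; rewrite free_act_gen.
  rewrite !inE => /or4P[|||/orP[]] /eqP -> v n;
    rewrite ?(free_actD, free_actN, gen2, free_act1) /= ?oddD ?odd_double //=.
  + by rewrite add0n doubleK subrr.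
  + by rewrite add0n uphalf_double subrr.
  + by have := odd_double_half n; case: (odd n) => /= ->;
      rewrite ?add0r ?addr0 subrr.
- exact: free_act0.
- by rewrite free_actD Ia Ib addr0.
- rewrite free_actM (free_act_eq a (w := fun=> 0)) //.
  apply: big1 => m _; have := mon_act_lin [::] (fun=> 0) (fun _ : unit => v) m n.
  rewrite big_nil (mon_act_eq m (w := fun=> 0)) => [->|k]; last exact: big_nil.
  exact: mulr0.
- by rewrite free_actM.
Qed.

Fact leavitt_ideal1 : ~ leavitt_ideal (1 : F).
Proof.
by move=> /free_act_ideal /(_ (fun=> 1) 0%N) /eqP; rewrite free_act1 oner_eq0.
Qed.

End NonTrivial.

Section LeavittAlgebra.
Variable K : fieldType.
Local Notation F := (free_algebra K).
Local Notation L := (leavitt K).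

Lemma leavitt_piP (a b : F) :
  reflect (leavitt_ideal (a - b)) (\pi_L a == \pi_L b).
Proof. by rewrite -Quotient.idealrBE; exact: asboolP. Qed.

Lemma leavitt_pi (x : L) : exists a, x = \pi_L a.
Proof. by exists (repr x); rewrite reprK. Qed.

Lemma leavitt_pi0 : \pi_L (0 : F) = 0.
Proof. exact: pi_zeror. Qed.

Lemma leavitt_piD (a b : F) : \pi_L (a + b) = \pi_L a + \pi_L b.
Proof. exact: pi_addr. Qed.

Definition leavitt_one : L := \pi_L 1.
Definition leavitt_mul (x y : L) : L := \pi_L (repr x * repr y).
Definition leavitt_scale (c : K) (x : L) : L := \pi_L (c *: repr x).

Fact leavitt_repr (a : F) : leavitt_ideal (repr (\pi_L a) - a).
Proof. by apply/leavitt_piP; rewrite reprK. Qed.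

Fact leavitt_piM (a b : F) : leavitt_mul (\pi_L a) (\pi_L b) = \pi_L (a * b).
Proof.
apply/eqP/leavitt_piP; set a' := repr _; set b' := repr _.
have -> : a' * b' - a * b = (a' - a) * b' + a * (b' - b).
  by rewrite mulrBl mulrBr addrA subrK.
by apply: leavitt_idealD; [apply: leavitt_idealMr | apply: leavitt_idealMl];
   exact: leavitt_repr.
Qed.

Fact leavitt_piZ c (a : F) : leavitt_scale c (\pi_L a) = \pi_L (c *: a).
Proof.
apply/eqP/leavitt_piP; rewrite -scalerBr -mul_malgC.
exact/leavitt_idealMl/leavitt_repr.
Qed.

Fact leavitt_mulA : associative leavitt_mul.
Proof.
move=> x y z; case: (leavitt_pi x) (leavitt_pi y) (leavitt_pi z).
by move=> a -> [b ->] [c ->]; rewrite !leavitt_piM mulrA.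
Qed.

Fact leavitt_mul1x : left_id leavitt_one leavitt_mul.
Proof. by move=> x; have [a ->] := leavitt_pi x; rewrite leavitt_piM mul1r. Qed.

Fact leavitt_mulx1 : right_id leavitt_one leavitt_mul.
Proof. by move=> x; have [a ->] := leavitt_pi x; rewrite leavitt_piM mulr1. Qed.

Fact leavitt_mulDl : left_distributive leavitt_mul +%R.
Proof.
move=> x y z; case: (leavitt_pi x) (leavitt_pi y) (leavitt_pi z).
by move=> a -> [b ->] [c ->]; rewrite -leavitt_piD !leavitt_piM -leavitt_piD mulrDl.
Qed.

Fact leavitt_mulDr : right_distributive leavitt_mul +%R.
Proof.
move=> x y z; case: (leavitt_pi x) (leavitt_pi y) (leavitt_pi z).
by move=> a -> [b ->] [c ->]; rewrite -leavitt_piD !leavitt_piM -leavitt_piD mulrDr.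
Qed.

Fact leavitt_one_neq0 : leavitt_one != 0.
Proof.
apply/negP; rewrite -leavitt_pi0 => /leavitt_piP.
by rewrite subr0; exact: leavitt_ideal1.
Qed.

HB.instance Definition _ := GRing.Zmodule_isNzRing.Build L
  leavitt_mulA leavitt_mul1x leavitt_mulx1 leavitt_mulDl leavitt_mulDr
  leavitt_one_neq0.

Fact leavitt_scaleA b c (x : L) :
  leavitt_scale b (leavitt_scale c x) = leavitt_scale (b * c) x.
Proof. by have [a ->] := leavitt_pi x; rewrite !leavitt_piZ scalerA. Qed.

Fact leavitt_scale1 : left_id 1 leavitt_scale.
Proof. by move=> x; have [a ->] := leavitt_pi x; rewrite leavitt_piZ scale1r. Qed.

Fact leavitt_scaleDr : right_distributive leavitt_scale +%R.
Proof.
move=> c x y; have [[a ->] [b ->]] := conj (leavitt_pi x) (leavitt_pi y).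
by rewrite -leavitt_piD !leavitt_piZ -leavitt_piD scalerDr.
Qed.

Fact leavitt_scaleDl (x : L) : {morph leavitt_scale^~ x : b c / b + c}.
Proof. by move=> b c; have [a ->] := leavitt_pi x; rewrite !leavitt_piZ -leavitt_piD scalerDl. Qed.

HB.instance Definition _ := GRing.Zmodule_isLmodule.Build K L
  leavitt_scaleA leavitt_scale1 leavitt_scaleDr leavitt_scaleDl.

Lemma leavitt_pi1 : \pi_L (1 : F) = 1.
Proof. by []. Qed.

Lemma leavitt_piME (a b : F) : \pi_L (a * b) = \pi_L a * \pi_L b.
Proof. exact/esym/leavitt_piM. Qed.

Lemma leavitt_piZE c (a : F) : \pi_L (c *: a) = c *: \pi_L a.
Proof. exact/esym/leavitt_piZ. Qed.

Fact leavitt_scaleAl c (x y : L) : c *: (x * y) = (c *: x) * y.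
Proof.
have [[a ->] [b ->]] := conj (leavitt_pi x) (leavitt_pi y).
by rewrite -leavitt_piME -!leavitt_piZE -leavitt_piME scalerAl.
Qed.

HB.instance Definition _ := GRing.Lmodule_isLalgebra.Build K L leavitt_scaleAl.

Fact free_scaleAr c (a b : F) : c *: (a * b) = a * (c *: b).
Proof.
apply/malgP => k; rewrite mcoeffZ mcoeffMl mulr_sumr.
rewrite (mcoeffMlw _ (fsubset_refl _) (msuppZ_le c b)).
apply: eq_bigr => m1 _; rewrite mulr_sumr; apply: eq_bigr => m2 _.
by rewrite mcoeffZ mulrnAr mulrCA.
Qed.

Fact leavitt_scaleAr c (x y : L) : c *: (x * y) = x * (c *: y).
Proof.
have [[a ->] [b ->]] := conj (leavitt_pi x) (leavitt_pi y).
by rewrite -leavitt_piME -!leavitt_piZE -leavitt_piME free_scaleAr.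
Qed.

HB.instance Definition _ := GRing.Lalgebra_isAlgebra.Build K L leavitt_scaleAr.

(* The unit group is not decidable a priori, so the unit ring structure on the
   algebra is the classical one: units are the two-sided invertible elements. *)
Definition leavitt_invertible (x : L) : Prop := exists y, y * x = 1 /\ x * y = 1.

Definition leavitt_unit : pred L := fun x => `[< leavitt_invertible x >].

Definition leavitt_inv (x : L) : L :=
  if pselect (leavitt_invertible x) is left xU then sval (cid xU) else x.

Fact leavitt_mulVx : {in leavitt_unit, left_inverse 1 leavitt_inv *%R}.
Proof.
move=> x /asboolP xU; rewrite /leavitt_inv; case: pselect => // xU'.
by have [] := svalP (cid xU').
Qed.

Fact leavitt_mulxV : {in leavitt_unit, right_inverse 1 leavitt_inv *%R}.
Proof.
move=> x /asboolP xU; rewrite /leavitt_inv; case: pselect => // xU'.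
by have [] := svalP (cid xU').
Qed.

Fact leavitt_unitP (x y : L) : y * x = 1 /\ x * y = 1 -> leavitt_unit x.
Proof. by move=> yxK; apply/asboolP; exists y. Qed.

Fact leavitt_inv_out : {in [predC leavitt_unit], leavitt_inv =1 id}.
Proof.
move=> x /negP xNU; rewrite /leavitt_inv; case: pselect => // xU.
by case: xNU; apply/asboolP.
Qed.

HB.instance Definition _ := GRing.NzRing_hasMulInverse.Build L
  leavitt_mulVx leavitt_mulxV leavitt_unitP leavitt_inv_out.

Definition letter_elt (x : letter) : L := \pi_L (free_gen K (inl x)).
Definition letter_star (x : letter) : L := \pi_L (free_gen K (inr x)).

Definition word_elt (w : word) : L := \prod_(x <- w) letter_elt x.
Definition word_star (w : word) : L := \prod_(x <- rev w) letter_star x.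

Fact leavitt_pi_relator k : (k < 5)%N -> \pi_L (leavitt_relators K)`_k = 0.
Proof.
move=> k5; rewrite -leavitt_pi0; apply/eqP/leavitt_piP; rewrite subr0.
exact/leavitt_ideal_relator/mem_nth.
Qed.

Fact leavitt_pi_eq1 (a : F) : \pi_L (a - 1) = 0 -> \pi_L a = 1.
Proof.
by rewrite -leavitt_pi0 -leavitt_pi1 => /eqP/leavitt_piP; rewrite subr0 => /leavitt_piP/eqP.
Qed.

Lemma letter_starM (x y : letter) : letter_star x * letter_elt y = (x == y)%:R.
Proof.
rewrite -leavitt_piME; case: x; case: y.
- exact/leavitt_pi_eq1/(@leavitt_pi_relator 1).
- exact/(@leavitt_pi_relator 3).
- exact/(@leavitt_pi_relator 2).
- exact/leavitt_pi_eq1/(@leavitt_pi_relator 0).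
Qed.

Lemma letter_starE :
  letter_elt false * letter_star false + letter_elt true * letter_star true = 1.
Proof.
rewrite -!leavitt_piME -leavitt_piD.
exact/leavitt_pi_eq1/(@leavitt_pi_relator 4).
Qed.

Definition leaf_unit n (A : n.-tuple word) (M : 'M[K]_n) (B : n.-tuple word) : L :=
  \sum_(i < n) \sum_(j < n) M i j *: (word_elt (tnth A i) * word_star (tnth B j)).

End LeavittAlgebra.

Section LeafSets.
Local Open Scope fset_scope.

Definition full_subtree (T : {fset word}) : Prop :=
  [/\ [::] \in T,
      forall a b : word, a ++ b \in T -> a \in T
    & forall (c : word), c \in T ->
        (rcons c false \in T) = (rcons c true \in T)].

Definition leaves (T : {fset word}) : {fset word} :=
  [fset c in T | [forall x : letter, rcons c x \notin T]].

Definition leaf_set (S : {fset word}) : Prop :=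
  exists2 T, full_subtree T & S = leaves T.

Definition ordered_leaf_set n (A : n.-tuple word) : Prop :=
  uniq A /\ exists2 S, leaf_set S & A =i S.

End LeafSets.

(* The subgroup of the unit group generated by the elements u(A, M, B). *)
Inductive LGL2 (K : fieldType) : leavitt K -> Prop :=
| LGL2_gen n (A B : n.-tuple word) (M : 'M[K]_n) :
    (1 <= n)%N -> ordered_leaf_set A -> ordered_leaf_set B -> M \in unitmx ->
    LGL2 (leaf_unit A M B)
| LGL2_1 : LGL2 1
| LGL2_M x y : LGL2 x -> LGL2 y -> LGL2 (x * y)
| LGL2_V x : LGL2 x -> LGL2 x^-1.

(* Main.v *)
Require Import Defs.
From mathcomp Require Import all_boot all_order all_algebra.
From mathcomp Require Import finmap boolp.
From mathcomp.multinomials Require Import monalg.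
From mathcomp Require Import zify ring.

Set Implicit Arguments.
Unset Strict Implicit.
Unset Printing Implicit Defensive.

Import GRing.Theory.
Local Open Scope ring_scope.
Local Open Scope quotient_scope.

(* Write F for the algebra of polynomials in e, f inside L, and let x be a unit.  For a
   leaf set B of long words the entries p_b = x b all lie in F, and x = \sum_b p_b b^*.  The
   p_b are the basis of a free right ideal J of F containing all long words.  Right
   multiplication of x by elements of LGL_2 performs elementary operations with
   coefficients in F on the row p, and allows B to be replaced by any leaf set of the same
   size, so that a pair of entries v e, v f may be merged into the single entry v.

   One merges until the row is a single nonzero scalar.  Take p of minimal total degree;
   then (this is Cohn's weak algorithm) \sum_i p_i c_i has degree max_i deg (p_i c_i).  If
   J is not F, choose v of minimal degree k outside J with v e, v f in J.  The entries of
   degree k + 1 occur in v e and v f with scalar coefficients only, and these two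
   coefficient vectors are independent, since otherwise stripping a last letter would
   give an element of degree < k with the same property as v.  So v e and v f can replace
   two entries of p, and they merge into v. *)

(** * The action on functions nat -> K *)

Section Representation.
Variable K : fieldType.
Local Notation F := (free_algebra K).
Local Notation L := (leavitt K).

Lemma free_actU c m v n : free_act << c *g m >> v n = c * mon_act m v n :> K.
Proof. exact: mmapU. Qed.

Lemma free_actD (a b : F) v n :
  free_act (a + b) v n = free_act a v n + free_act b v n.
Proof. exact: mmapD. Qed.

Lemma free_act0 v n : free_act (0 : F) v n = 0.
Proof. exact: mmap0. Qed.

Lemma free_act_sum T (r : seq T) (E : T -> F) v n :
  free_act (\sum_(i <- r) E i) v n = \sum_(i <- r) free_act (E i) v n.
Proof. by elim/big_rec2: _ => [|i y x _ <-]; rewrite ?free_act0 ?free_actD. Qed.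

Lemma mon_act_lin T (r : seq T) (c : T -> K) (w : T -> nat -> K) m n :
  mon_act m (fun n => \sum_(i <- r) c i * w i n) n
    = \sum_(i <- r) c i * mon_act m (w i) n.
Proof.
rewrite /mon_act; elim: (m : seq _) n => //= -[] x s IH n /=; last exact: IH.
by rewrite IH; case: ifP => // _; rewrite big1 // => i _; rewrite mulr0.
Qed.

Lemma free_actM (a b : F) v n :
  free_act (a * b) v n = free_act a (free_act b v) n.
Proof.
rewrite malgME free_act_sum; apply: eq_bigr => m1 _.
have -> := mon_act_lin (msupp b) (fun m => b@_m) (fun m => mon_act m v) m1 n.
rewrite free_act_sum mulr_sumr; apply: eq_bigr => m2 _.
by rewrite free_actU /mon_act fmM foldr_cat mulrA.
Qed.

Lemma free_act1 v : free_act (1 : F) v = v.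
Proof.
by apply/funext => n; rewrite -mpolyC1E (free_actU 1 mone v n) mul1r /mon_act fm1.
Qed.

Lemma free_act_gen g v : free_act (free_gen K g) v = gen_act g v.
Proof.
by apply/funext => n; rewrite (free_actU 1 (fmu g) v n) mul1r /mon_act fmU.
Qed.

Lemma free_actN (a : F) v n : free_act (- a) v n = - free_act a v n.
Proof. exact: mmapN. Qed.

Lemma free_act_ideal (a : F) : leavitt_ideal a -> forall v n, free_act a v n = 0.
Proof.
elim=> {a} [r|v n|a b _ Ia _ Ib v n|a b _ Ib v n|a b _ Ia v n].
- have gen2 g h v n : free_act (free_gen K g * free_gen K h) v n
      = gen_act g (gen_act h v) n by rewrite free_actM !free_act_gen.
  rewrite !inE => /or4P[|||/orP[]] /eqP -> v n.
  + by rewrite free_actD gen2 free_actN free_act1 /= odd_double add0n doubleK subrr.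
  + by rewrite free_actD gen2 free_actN free_act1 /= odd_double /= uphalf_double subrr.
  + by rewrite gen2 /= odd_double.
  + by rewrite gen2 /= odd_double.
  (* The index [n] has the parity of exactly one letter, so exactly one of the two products returns
     [v n]. *)
  + rewrite !free_actD free_actN free_act1.
    apply: etrans (congr1 (+%R^~ _) (congr2 +%R (gen2 _ _ v n) (gen2 _ _ v n))) _ => /=.
    by have := odd_double_half n; case: (odd n) => /= ->; rewrite ?add0r ?addr0 subrr.
- exact: free_act0.
- by rewrite free_actD Ia Ib addr0.
- rewrite free_actM (_ : free_act b v = fun=> 0); last exact/funext/Ib.
  apply: big1 => m _; have := mon_act_lin [::] (fun=> 0) (fun _ : unit => v) m n.
  rewrite big_nil (_ : (fun=> _) = (fun=> 0)); last by apply/funext => ?; rewrite big_nil.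
  by move=> ->; rewrite mulr0.
- by rewrite free_actM.
Qed.

Definition leavitt_act (a : L) (v : nat -> K) : nat -> K := free_act (repr a) v.

(** The ideal acts by zero, so the representative chosen by [repr] does not matter. *)
Lemma leavitt_act_pi (a : F) v : leavitt_act (\pi_L a) v = free_act a v.
Proof.
apply/funext => n; apply/eqP; rewrite -subr_eq0 -free_actN -free_actD.
exact/eqP/free_act_ideal/leavitt_repr.
Qed.

Lemma leavitt_actD (a b : L) v n :
  leavitt_act (a + b) v n = leavitt_act a v n + leavitt_act b v n.
Proof.
have [[a' ->] [b' ->]] := conj (leavitt_pi a) (leavitt_pi b).
by rewrite -leavitt_piD !leavitt_act_pi free_actD.
Qed.

Lemma leavitt_actZ c (a : L) v n : leavitt_act (c *: a) v n = c * leavitt_act a v n.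
Proof.
have [a' ->] := leavitt_pi a.
by rewrite -leavitt_piZE !leavitt_act_pi -mul_malgC free_actM free_actU /mon_act fm1.
Qed.

Lemma leavitt_actM (a b : L) v : leavitt_act (a * b) v = leavitt_act a (leavitt_act b v).
Proof.
have [[a' ->] [b' ->]] := conj (leavitt_pi a) (leavitt_pi b).
by rewrite -leavitt_piME !leavitt_act_pi; apply/funext => n; rewrite free_actM.
Qed.

Lemma leavitt_act1 v : leavitt_act 1 v = v.
Proof. by rewrite -leavitt_pi1 leavitt_act_pi free_act1. Qed.

Lemma leavitt_act_letter x v : leavitt_act (letter_elt K x) v = gen_act (inl x) v.
Proof. by rewrite leavitt_act_pi free_act_gen. Qed.

(** Monomials in the generators span the algebra, and each is built from 1 by left
    multiplications. *)
Lemma leavitt_ind (P : L -> Prop) :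
  P 1 -> (forall a b, P a -> P b -> P (a + b)) -> (forall c a, P a -> P (c *: a)) ->
  (forall x a, P a -> P (letter_elt K x * a)) ->
  (forall x a, P a -> P (letter_star K x * a)) -> forall a, P a.
Proof.
move=> P1 PD PZ Pe Ps a; have [{}a ->] := leavitt_pi a.
have P0 : P 0 by rewrite -(scale0r (1 : L)); apply: PZ.
have Pm (m : {fmonom (bool + bool)%type}) : P (\pi_L << m >>).
  case: m => s; elim: s => [|g s IH].
    by rewrite -fmoneE mpolyC1E leavitt_pi1.
  have -> : FMonom (g :: s) = mmul (fmu g) (FMonom s).
    by rewrite -[mmul _ _]fmK fmM fmU.
  have -> : << mmul (fmu g) (FMonom s) >> = << fmu g >> * << FMonom s >> :> F.
    by rewrite malgM_def fgmulUU mulr1.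
  by rewrite leavitt_piME; case: g => x; [apply: Pe | apply: Ps].
rewrite [a]monalgE; elim: (enum_fset _) => [|m s IH].
  by rewrite big_nil leavitt_pi0.
rewrite big_cons leavitt_piD; apply: PD => //.
have -> : << a@_m *g m >> = a@_m *: << m >> :> F.
  by rewrite -mul_malgC malgM_def fgmulUU mulr1 mul1m.
by rewrite leavitt_piZE; apply: PZ.
Qed.

End Representation.

(** * Leaf sets *)

Section LeafSequences.

(** Unfolds to the same condition as [ordered_leaf_set]; with sequences the length may change under
    expansion. *)
Definition leaf_seq (s : seq word) :=
  uniq s /\ exists2 S : {fset word}, leaf_set S & s =i S.

Lemma mem_leaves (T : {fset word}) (c : word) :
  (c \in leaves T) = (c \in T) && [forall x : bool, rcons c x \notin T].
Proof. by rewrite in_fset inE. Qed.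

(** A proper extension of [c] in [T] would, by prefix closure, put a child of [c] into [T]. *)
Lemma leaves_prefix (T : {fset word}) (c d : word) : full_subtree T ->
  c \in leaves T -> d \in T -> prefix c d -> c = d.
Proof.
move=> [_ Tcat _]; rewrite mem_leaves => /andP[_ /forallP cN] dT /prefixP[[|x u] dE].
  by rewrite dE cats0.
by move: dT; rewrite dE -cat_rcons => /Tcat; rewrite (negPf (cN x)).
Qed.

Lemma leaf_seq_prefix s c d : leaf_seq s -> c \in s -> d \in s -> prefix c d -> c = d.
Proof.
move=> [_ [S [T fT ->] sS]]; rewrite !sS => cT; rewrite mem_leaves => /andP[dT _].
exact: leaves_prefix fT cT dT.
Qed.

Lemma leaf_seq_perm s s' : perm_eq s s' -> leaf_seq s -> leaf_seq s'.
Proof.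
move=> ss' [us [S lS sS]]; split; first by rewrite -(perm_uniq ss').
by exists S => // c; rewrite -(perm_mem ss').
Qed.

Lemma leaf_seq_nil : leaf_seq [:: [::]].
Proof.
split=> //; exists [fset [::]]%fset => [|c]; last by rewrite !inE.
exists [fset [::]]%fset; last first.
  apply/fsetP => c; rewrite mem_leaves !inE; case: eqP => //= ->.
  by apply/esym/forallP => x; rewrite inE.
split=> [|a b|c]; rewrite !inE //; first by case: a.
by move=> /eqP->.
Qed.

Lemma leaf_seq_expand c s : leaf_seq (c :: s) ->
  leaf_seq (rcons c false :: rcons c true :: s).
Proof.
move=> [/= /andP[cs us] [S [T fT ->] sS]].
have /andP[cT /forallP cN] : (c \in T) && [forall x : bool, rcons c x \notin T].
  by rewrite -mem_leaves -sS mem_head.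
have rs x : rcons c x \notin s.
  apply/negP => rs; have : rcons c x \in c :: s by rewrite inE rs orbT.
  by rewrite sS mem_leaves (negPf (cN x)).
have [T0 Tcat Tsib] := fT.
pose T' := (rcons c false |` (rcons c true |` T))%fset.
have T'E d : d \in T' = (d \in T) || [exists x, d == rcons c x].
  have -> : [exists x, d == rcons c x] = (d == rcons c false) || (d == rcons c true).
    by apply/existsP/orP => [[[] ?]|[]]; [right|left|exists false|exists true].
  by rewrite !inE orbA orbC.
have T'r d x : (rcons d x \in T') = (rcons d x \in T) || (d == c).
  rewrite T'E; congr (_ || _); apply/existsP/eqP => [[y /eqP/rcons_inj[]] //|->].
  by exists x.
have rT d x : (rcons d x \in T) -> d \in T by rewrite -cats1; apply: Tcat.
have fT' : full_subtree T'.
  split=> [|a b|d].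
  - by rewrite T'E T0.
  - case/lastP: b => [|b y]; first by rewrite cats0.
    rewrite -rcons_cat T'r T'E => /orP[/rT/Tcat->//|/eqP abc].
    by rewrite (Tcat a b) // abc.
  - rewrite T'E !T'r => /orP[dT|/existsP[x /eqP dE]]; first by rewrite Tsib.
    have dT : d \notin T by rewrite dE.
    by congr (_ || _); apply/idP/idP => /rT; rewrite (negPf dT).
split; first by rewrite /= inE !negb_or !rs us eqseq_rcons andbF.
exists (leaves T'); first by exists T'.
have rleaf x : rcons c x \in leaves T'.
  rewrite mem_leaves T'r eqxx orbT; apply/forallP => y; rewrite T'r negb_or.
  apply/andP; split; first by apply/negP => /rT; apply/negP.
  by apply/eqP => /(congr1 size); rewrite size_rcons; lia.
move=> d; rewrite !in_cons.
have [->|d0] := eqVneq d (rcons c false); first by rewrite rleaf.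
have [->|d1] := eqVneq d (rcons c true); first by rewrite rleaf.
(* For such [d], membership in [T'] and in [T] agree, and being a leaf can change only at
   [d = c]. *)
have dr x : d != rcons c x by case: x.
rewrite /= mem_leaves T'E; have [->|dc] := eqVneq d c.
  rewrite (negPf cs); apply/esym/andP => -[_ /forallP/(_ true)].
  by rewrite T'r eqxx orbT.
have -> : d \in s = (d \in leaves T) by rewrite -sS in_cons (negPf dc).
rewrite mem_leaves; congr (_ && _).
  by rewrite [X in _ || X](_ : _ = false) ?orbF //; apply/existsP => -[x]; rewrite (negPf (dr x)).
by apply: eq_forallb => x; rewrite T'r (negPf dc) orbF.
Qed.

Lemma leaf_seq_expand_mem c s : leaf_seq s -> c \in s ->
  leaf_seq (rcons c false :: rcons c true :: rem c s).
Proof. by move=> ls cs; apply/leaf_seq_expand/leaf_seq_perm/ls/perm_to_rem. Qed.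

Lemma leaf_seq_size n : exists2 s, leaf_seq s & size s = n.+1.
Proof.
elim: n => [|n [s ls sn]]; first by exists [:: [::]] => //; apply: leaf_seq_nil.
case: s ls sn => // c s ls [sn].
by exists (rcons c false :: rcons c true :: s); [apply: leaf_seq_expand | rewrite /= sn].
Qed.

Lemma leaf_tuple_exists n : (0 < n)%N -> exists A : n.-tuple word, ordered_leaf_set A.
Proof.
case: n => // n _; have [s ls /eqP sn] := leaf_seq_size n.
by exists (Tuple sn).
Qed.

Lemma leaf_seq_long N : exists2 s, leaf_seq s & forall c, c \in s -> (N <= size c)%N.
Proof.
elim: N => [|N [s ls sN]]; first by exists [:: [::]] => //; apply: leaf_seq_nil.
suff [t [lt tN]] : exists t, leaf_seq (t ++ [::]) /\
    forall c, c \in t -> (N < size c)%N by exists t => //; rewrite -[t]cats0.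
(* Here [t] holds the leaves already expanded and [s] those still waiting. *)
have : exists t, leaf_seq (t ++ s) /\ forall c, c \in t -> (N < size c)%N.
  by exists [::].
elim: s sN {ls} => // c s IH sN [t [lt tN]]; apply: IH.
  by move=> d ds; apply: sN; rewrite inE ds orbT.
exists (rcons c false :: rcons c true :: t); split=> [|d].
  by apply: leaf_seq_expand; apply: leaf_seq_perm lt; rewrite -cat1s perm_catCA.
have cN := sN _ (mem_head _ _).
by rewrite !inE => /or3P[/eqP->|/eqP->|/tN //]; rewrite size_rcons.
Qed.

End LeafSequences.

(** * Algebras with a Leavitt family *)

Section LeavittFamily.
Variables (K : fieldType) (L : algType K) (el st : bool -> L).
Hypothesis letter_relM : forall x y, st x * el y = (x == y)%:R.
Hypothesis letter_relE : \sum_x el x * st x = 1.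

Definition word_of (w : word) : L := \prod_(x <- w) el x.
Definition wordstar_of (w : word) : L := \prod_(x <- rev w) st x.

Local Notation E x := (el x).
Local Notation W w := (word_of w).
Local Notation Ws w := (wordstar_of w).

Lemma word_of_nil : word_of [::] = 1.
Proof. exact: big_nil. Qed.

Lemma wordstar_of_nil : wordstar_of [::] = 1.
Proof. exact: big_nil. Qed.

Lemma word_of_cat v w : word_of (v ++ w) = word_of v * word_of w.
Proof. exact: big_cat. Qed.

Lemma wordstar_of_cat v w : wordstar_of (v ++ w) = wordstar_of w * wordstar_of v.
Proof. by rewrite /wordstar_of rev_cat big_cat. Qed.

Lemma word_of1 x : word_of [:: x] = E x.
Proof. exact: big_seq1. Qed.

Lemma wordstar_of1 x : wordstar_of [:: x] = st x.
Proof. exact: big_seq1. Qed.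

Lemma word_of_cons x w : word_of (x :: w) = E x * word_of w.
Proof. exact: big_cons. Qed.

Lemma wordstar_ofK w : wordstar_of w * word_of w = 1.
Proof.
elim: w => [|x w IH]; first by rewrite word_of_nil wordstar_of_nil mulr1.
rewrite -cat1s wordstar_of_cat word_of_cat word_of1 wordstar_of1 -mulrA.
by rewrite [st x * _]mulrA letter_relM eqxx mul1r.
Qed.

Lemma eq_letterP (a b : L) : (forall x, a * E x = b * E x) -> a = b.
Proof.
move=> ab; rewrite -[a]mulr1 -[b]mulr1 -letter_relE !mulr_sumr.
by apply: eq_bigr => x _; rewrite !mulrA ab.
Qed.

(** * Polynomials in the letters *)

(* [poly_lt k a] says that [a] is a combination of words of length < k. *)
Fixpoint poly_lt k (a : L) : Prop :=
  if k is k'.+1 then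
    exists (c : K) (b : bool -> L),
      a = c%:A + \sum_x b x * E x /\ forall x, poly_lt k' (b x)
  else a = 0.

Definition is_poly a := exists k, poly_lt k a.

Lemma poly_lt0 k : poly_lt k 0.
Proof.
elim: k => //= k IH; exists 0, (fun=> 0); split=> //.
by rewrite scale0r add0r big1 // => x _; rewrite mul0r.
Qed.

Lemma poly_ltD k a b : poly_lt k a -> poly_lt k b -> poly_lt k (a + b).
Proof.
elim: k a b => [|k IH] a b /=; first by move=> -> ->; rewrite addr0.
move=> [c [f [-> Pf]]] [d [g [-> Pg]]].
exists (c + d), (fun x => f x + g x); split=> [|x]; last exact: IH.
under [X in _ = _ + X]eq_bigr do rewrite mulrDl.
by rewrite big_split scalerDl addrACA.
Qed.

Lemma poly_ltZ k c a : poly_lt k a -> poly_lt k (c *: a).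
Proof.
elim: k a => [|k IH] a /=; first by move=> ->; rewrite scaler0.
move=> [d [f [-> Pf]]]; exists (c * d), (fun x => c *: f x); split=> [|x].
  rewrite scalerDr scalerA scaler_sumr; congr (_ + _).
  by apply: eq_bigr => x _; rewrite scalerAl.
exact: IH.
Qed.

Lemma poly_ltN k a : poly_lt k a -> poly_lt k (- a).
Proof. by rewrite -scaleN1r; apply: poly_ltZ. Qed.

Lemma poly_lt_sum k I (r : seq I) (P : pred I) (f : I -> L) :
  (forall i, P i -> poly_lt k (f i)) -> poly_lt k (\sum_(i <- r | P i) f i).
Proof.
move=> Pf; apply: (big_ind (poly_lt k)) => //; first exact: poly_lt0.
by move=> *; apply: poly_ltD.
Qed.

Lemma poly_ltW k l a : (k <= l)%N -> poly_lt k a -> poly_lt l a.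
Proof.
elim: l k a => [|l IH] [|k] a //=.
- by move=> _ ->; apply: (poly_lt0 l.+1).
- move=> kl [c [f [-> Pf]]]; exists c, f; split=> // x; exact: IH (Pf x).
Qed.

Lemma poly_ltC k c : poly_lt k.+1 c%:A.
Proof.
exists c, (fun=> 0); split=> [|x]; last exact: poly_lt0.
by rewrite big1 ?addr0 // => x _; rewrite mul0r.
Qed.

Lemma poly_lt_letter k a x : poly_lt k a -> poly_lt k.+1 (a * E x).
Proof.
move=> Pa; exists 0, (fun y => if y == x then a else 0); split=> [|y].
  rewrite scale0r add0r (bigD1 x) //= eqxx big1 ?addr0 // => y /negPf->.
  by rewrite mul0r.
by case: ifP => // _; apply: poly_lt0.
Qed.

(** A form of the recursion uniform in [k]: at [k = 0] the predecessor is again 0, so the [b x]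
    vanish, and the last clause makes the constant vanish as well. *)
Lemma poly_lt_split k a : poly_lt k a -> exists (c : K) (b : bool -> L),
  [/\ a = c%:A + \sum_x b x * E x, forall x, poly_lt k.-1 (b x) & k = 0%N -> c = 0].
Proof.
case: k => [->|k [c [b [-> Pb]]]]; last by exists c, b.
exists 0, (fun=> 0); split=> //; rewrite scale0r add0r big1 // => x _.
by rewrite mul0r.
Qed.

Lemma is_polyD a b : is_poly a -> is_poly b -> is_poly (a + b).
Proof.
move=> [k Pa] [l Pb]; exists (maxn k l); apply: poly_ltD.
  exact: poly_ltW (leq_maxl _ _) Pa.
exact: poly_ltW (leq_maxr _ _) Pb.
Qed.

Lemma is_polyZ c a : is_poly a -> is_poly (c *: a).
Proof. by move=> [k Pa]; exists k; apply: poly_ltZ. Qed.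

Lemma is_polyB a b : is_poly a -> is_poly b -> is_poly (a - b).
Proof. by move=> Pa Pb; rewrite -scaleN1r; apply: is_polyD => //; apply: is_polyZ. Qed.

Lemma is_poly_sum I (r : seq I) (P : pred I) (f : I -> L) :
  (forall i, P i -> is_poly (f i)) -> is_poly (\sum_(i <- r | P i) f i).
Proof.
move=> Pf; apply: (big_ind is_poly) => //; first by exists 0%N.
by move=> *; apply: is_polyD.
Qed.

Lemma is_poly_letter a x : is_poly a -> is_poly (a * E x).
Proof. by move=> [k Pa]; exists k.+1; apply: poly_lt_letter. Qed.

Lemma is_polyC c : is_poly c%:A.
Proof. by exists 1%N; apply: poly_ltC. Qed.

Lemma is_poly_word w : is_poly (word_of w).
Proof.
elim/last_ind: w => [|w x IH].
  by rewrite word_of_nil -[1]scale1r; apply: is_polyC.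
by rewrite -cats1 word_of_cat word_of1; apply: is_poly_letter.
Qed.

(** The star cancels against the first letter of each word. The extra letter [y] serves the constant
    term of [a]; the suffix [w] is general because the induction moves the last letters of [a] into
    it. *)
Lemma is_poly_star x a y w : is_poly a -> is_poly (st x * a * word_of (y :: w)).
Proof.
move=> [k]; elim: k a y w => [|k IH] a y w /=.
  by move=> ->; rewrite mulr0 mul0r; exists 0%N.
move=> [c [b [-> Pb]]]; rewrite mulrDr mulrDl; apply: is_polyD.
  rewrite -scalerAr mulr1 -scalerAl; apply: is_polyZ; rewrite word_of_cons mulrA.
  by rewrite letter_relM; case: eqP => _; rewrite ?mul1r ?mul0r;
    [apply: is_poly_word | exists 0%N].
rewrite mulr_sumr mulr_suml; apply: is_poly_sum => z _.
by rewrite !mulrA -[_ * E z * _]mulrA -word_of_cons; apply: IH.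
Qed.

(** * Orthogonality and completeness of leaf sets *)

Lemma eq_wordP N (a b : L) :
  (forall w, size w = N -> a * W w = b * W w) -> a = b.
Proof.
elim: N a b => [|N IH] a b ab.
  by have := ab [::] erefl; rewrite word_of_nil !mulr1.
apply: eq_letterP => x; apply: IH => w wN.
by rewrite -!mulrA -word_of_cons ab //= wN.
Qed.

Lemma wordstar_ofM0 v w : ~~ prefix v w -> ~~ prefix w v -> Ws v * W w = 0.
Proof.
elim: v w => [|x v IH] [|y w] //=; rewrite /= ?prefix0s //= => vw wv.
rewrite -cat1s wordstar_of_cat wordstar_of1 word_of_cons -mulrA [st _ * _]mulrA.
rewrite letter_relM; move: vw wv; rewrite eq_sym.
by case: eqP => _ /=; [rewrite mul1r; apply: IH | rewrite mul0r mulr0].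
Qed.

Lemma leaf_seq_starM s c d : leaf_seq s -> c \in s -> d \in s ->
  Ws c * W d = (c == d)%:R.
Proof.
move=> ls cs ds; case: eqP => [->|cd]; first exact: wordstar_ofK.
apply: wordstar_ofM0; apply/negP.
  by move=> /(leaf_seq_prefix ls cs ds).
by move=> /(leaf_seq_prefix ls ds cs) /esym.
Qed.

(** It is enough to multiply by words longer than every vertex of the tree. Such a word passes
    through exactly one leaf, and only the term of that leaf survives. *)
Lemma leaf_seq_sum s : leaf_seq s -> \sum_(c <- s) W c * Ws c = 1.
Proof.
move=> ls; have [us [S [T fT SE] sS]] := ls.
pose N := (\max_(c <- T) size c)%N.+1.
apply: (@eq_wordP N) => w wN; rewrite mul1r.
have [T0 Tcat Tsib] := fT.
have wT : w \notin T.
  apply/negP => wT; have : (size w <= (\max_(c <- T) size c)%N)%N.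
    exact: (@leq_bigmax_seq _ _ xpredT (fun c => size c) w wT isT).
  by rewrite wN ltnn.
(* The longest prefix of [w] in [T] is a leaf: one of its children is outside [T], hence both
   are. *)
have [c [u cs ->]] : exists c, exists2 u, c \in s & w = c ++ u.
  elim/last_ind: w {wN} wT => [|w x IH] wT; first by rewrite T0 in wT.
  have [wT'|/IH[c [u cs ->]]] := boolP (w \in T); last first.
    by exists c, (rcons u x); rewrite ?rcons_cat.
  exists w, [:: x]; last by rewrite cats1.
  rewrite sS SE mem_leaves wT'; apply/forallP => y.
  by have := Tsib _ wT'; move: wT; case: x; case: y => // /negPf ->; [move=> -> | move=> <-].
rewrite word_of_cat mulrA; congr (_ * _); rewrite mulr_suml (bigD1_seq c) //=.
rewrite -mulrA wordstar_ofK mulr1 big_seq_cond big1 ?addr0 // => d /andP[ds dc].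
by rewrite -mulrA (leaf_seq_starM ls) // (negPf dc) mulr0.
Qed.

Lemma leaf_tuple_starM n (A : n.-tuple word) i j : ordered_leaf_set A ->
  Ws (tnth A i) * W (tnth A j) = (i == j)%:R.
Proof.
move=> lA; have [uA _] := lA.
rewrite (leaf_seq_starM (s := A)) ?mem_tnth //; congr (_%:R); congr (nat_of_bool _).
by rewrite !(tnth_nth [::]) nth_uniq ?size_tuple ?ltn_ord.
Qed.

Lemma leaf_tuple_sum n (A : n.-tuple word) : ordered_leaf_set A ->
  \sum_i W (tnth A i) * Ws (tnth A i) = 1.
Proof. by move=> /leaf_seq_sum; rewrite big_tuple. Qed.

Lemma letter_relE_bool : el false * st false + el true * st true = 1.
Proof. by rewrite -letter_relE big_bool addrC. Qed.

(** * Leaf units, their products, and the elementary operations they generate *)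

Definition leaf_unit_of n (A : n.-tuple word) (M : 'M[K]_n) (B : n.-tuple word) : L :=
  \sum_(i < n) \sum_(j < n) M i j *: (W (tnth A i) * Ws (tnth B j)).

(* [G] stands for [LGL2]. *)
Variable G : L -> Prop.
Hypothesis G1 : G 1.
Hypothesis GM : forall x y, G x -> G y -> G (x * y).
Hypothesis Ggen : forall n (A B : n.-tuple word) (M : 'M[K]_n),
  (1 <= n)%N -> ordered_leaf_set A -> ordered_leaf_set B -> M \in unitmx ->
  G (leaf_unit_of A M B).

(** The element [x] with [x b_i = p_i] for the leaves [b_i] of [B]; right multiplication by leaf
    units then acts on the row [p] by column operations. *)
Definition row_sum n (p : 'I_n -> L) (B : n.-tuple word) :=
  \sum_i p i * Ws (tnth B i).

Lemma leaf_unitE n (A B : n.-tuple word) (M : 'M[K]_n) :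
  leaf_unit_of A M B = row_sum (fun j => \sum_i M i j *: W (tnth A i)) B.
Proof.
rewrite /leaf_unit_of exchange_big; apply: eq_bigr => j _.
by rewrite mulr_suml; apply: eq_bigr => i _; rewrite scalerAl.
Qed.

Lemma row_sum_word n (p : 'I_n -> L) (B : n.-tuple word) j : ordered_leaf_set B ->
  row_sum p B * W (tnth B j) = p j.
Proof.
move=> lB; rewrite /row_sum mulr_suml (bigD1 j) //= -[p j * _ * _]mulrA leaf_tuple_starM // eqxx mulr1.
rewrite big1 ?addr0 // => i /negPf ij.
by rewrite -mulrA leaf_tuple_starM // ij mulr0.
Qed.

Lemma row_sum_leaf_unit n (p : 'I_n -> L) (B C : n.-tuple word) (M : 'M[K]_n) :
  ordered_leaf_set B -> row_sum p B * leaf_unit_of B M C =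
    row_sum (fun j => \sum_i M i j *: p i) C.
Proof.
move=> lB; rewrite leaf_unitE {2}/row_sum mulr_sumr; apply: eq_bigr => j _.
rewrite mulrA; congr (_ * _); rewrite mulr_sumr; apply: eq_bigr => i _.
by rewrite -scalerAr row_sum_word.
Qed.

Lemma leaf_unitM n (A B C : n.-tuple word) (M N : 'M[K]_n) : ordered_leaf_set B ->
  leaf_unit_of A M B * leaf_unit_of B N C = leaf_unit_of A (M *m N) C.
Proof.
move=> lB; rewrite [leaf_unit_of A M B]leaf_unitE row_sum_leaf_unit // leaf_unitE; apply: eq_bigr => k _; congr (_ * _).
under eq_bigr do rewrite scaler_sumr.
rewrite exchange_big; apply: eq_bigr => i _; rewrite mxE scaler_suml.
by apply: eq_bigr => j _; rewrite scalerA mulrC.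
Qed.

Lemma leaf_unitD n (A B : n.-tuple word) (M N : 'M[K]_n) :
  leaf_unit_of A (M + N) B = leaf_unit_of A M B + leaf_unit_of A N B.
Proof.
rewrite /leaf_unit_of -big_split; apply: eq_bigr => i _.
by rewrite -big_split; apply: eq_bigr => j _; rewrite mxE scalerDl.
Qed.

Lemma leaf_unit1 n (A : n.-tuple word) : ordered_leaf_set A ->
  leaf_unit_of A 1%:M A = 1 :> L.
Proof.
move=> /leaf_tuple_sum <-; rewrite leaf_unitE /row_sum; apply: eq_bigr => j _.
rewrite (bigD1 j) //= mxE eqxx scale1r big1 ?addr0 // => i /negPf ij.
by rewrite mxE ij scale0r.
Qed.

Lemma leaf_unitV n (A B : n.-tuple word) (M : 'M[K]_n) :
  ordered_leaf_set A -> ordered_leaf_set B -> M \in unitmx ->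
  leaf_unit_of B (invmx M) A * leaf_unit_of A M B = 1 /\
  leaf_unit_of A M B * leaf_unit_of B (invmx M) A = 1.
Proof. by move=> lA lB uM; rewrite !leaf_unitM // mulmxV // mulVmx // !leaf_unit1. Qed.

Lemma leaf_unit_delta n (A B : n.-tuple word) k i j :
  leaf_unit_of A (k *: delta_mx i j) B = k *: (W (tnth A i) * Ws (tnth B j)).
Proof.
rewrite /leaf_unit_of (bigD1 i) //= (bigD1 j) //= big1 => [|l /negPf lj]; last first.
  by rewrite !mxE lj andbF mulr0 scale0r.
rewrite big1 => [|l /negPf li]; last first.
  by rewrite big1 // => m _; rewrite !mxE li mulr0 scale0r.
by rewrite !addr0 !mxE !eqxx mulr1.
Qed.

(** The equation says that [1 + k E] and [1 + k' E] are inverse for the matrix unit [E] at [c, d].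
    It covers transvections, with [k' = - k], and scalings of one coordinate, with [c = d]. *)
Lemma G_delta s c d (k k' : K) : leaf_seq s -> c \in s -> d \in s ->
  k + k' + (c == d)%:R * (k * k') = 0 -> G (1 + k *: (W c * Ws d)).
Proof.
move=> ls cs ds kk'.
pose i : 'I_(size s) := Ordinal (etrans (index_mem c s) cs).
pose j : 'I_(size s) := Ordinal (etrans (index_mem d s) ds).
have lS : ordered_leaf_set (in_tuple s) by [].
have -> : c = tnth (in_tuple s) i by rewrite (tnth_nth [::]) nth_index.
have -> : d = tnth (in_tuple s) j by rewrite (tnth_nth [::]) nth_index.
rewrite -leaf_unit_delta -(leaf_unit1 lS) -leaf_unitD.
have ij : (i == j) = (c == d).
  apply/eqP/eqP => [/(congr1 (tnth (in_tuple s)))|cd].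
    by rewrite !(tnth_nth [::]) /= !nth_index.
  by apply/val_inj; rewrite /= cd.
apply: Ggen => //; first exact: leq_ltn_trans (leq0n i) (ltn_ord i).
suff /mulmx1_unit[] : (1%:M + k *: delta_mx i j) *m (1%:M + k' *: delta_mx i j) = 1%:M.
  by [].
rewrite mulmxDl mul1mx mulmxDr mulmx1 -scalemxAl -scalemxAr mul_delta_mx_cond.
rewrite -addrA [_ *: _ + (_ + _)]addrA -scalerDl eq_sym ij scalerA -scaler_nat scalerA.
by rewrite -scalerDl [k * k' * _]mulrC [k' + k]addrC kk' scale0r addr0.
Qed.

(** Expanding the leaf set along [w] below [c] makes [c ++ w] a leaf while [d] stays one. *)
Lemma G_word s c d k w : leaf_seq s -> c \in s -> d \in s -> c != d ->
  G (1 + k *: (W (c ++ w) * Ws d)).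
Proof.
elim: w s c => [|x w IH] s c ls cs ds cd.
  rewrite cats0; apply: (G_delta (k' := - k) ls cs ds).
  by rewrite (negPf cd) mul0r addr0 subrr.
have ls' := leaf_seq_expand_mem ls cs.
have dr : d \in rem c s.
  by case: ls => us _; rewrite (mem_rem_uniq _ us) inE eq_sym cd.
rewrite -cat_rcons; apply: (IH _ _ ls').
- by rewrite !inE; case: x; rewrite eqxx ?orbT.
- by rewrite !inE dr !orbT.
- case: ls' => /= /and3P[]; rewrite inE negb_or => /andP[_ fr] tr _ _.
  have : rcons c x \notin rem c s by case: x.
  by apply: contraNneq => ->.
Qed.

(* The cross term vanishes because [d^* c = 0]. *)
Lemma G_transvectionD s c d (a b : L) : leaf_seq s -> c \in s -> d \in s -> c != d ->
  G (1 + W c * a * Ws d) -> G (1 + W c * b * Ws d) ->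
  G (1 + W c * (a + b) * Ws d).
Proof.
move=> ls cs ds cd Ga Gb; have := GM Ga Gb.
rewrite mulrDl mul1r mulrDr mulr1 !mulrA -[_ * Ws d * W c]mulrA.
rewrite (leaf_seq_starM ls) // eq_sym (negPf cd) mulr0 !mul0r addr0.
by rewrite -addrA -mulrDl -mulrDr [b + a]addrC.
Qed.

Lemma G_transvection s c d (a : L) : leaf_seq s -> c \in s -> d \in s -> c != d ->
  is_poly a -> G (1 + W c * a * Ws d).
Proof.
(* The empty word inserted here collects the last letters of [a] as the induction splits them
   off. *)
move=> ls cs ds cd [k Pa]; rewrite -[a]mulr1 -[X in a * X]word_of_nil.
elim: k a [::] Pa => [|k IH] a w /=.
  by move=> ->; rewrite mul0r mulr0 mul0r addr0; apply: G1.
move=> [x [b [-> Pb]]]; rewrite mulrDl big_bool /= mulrDl.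
apply: (G_transvectionD ls cs ds cd); last apply: (G_transvectionD ls cs ds cd).
- rewrite mulr_algl -scalerAr -scalerAl -word_of_cat.
  exact: (G_word _ _ ls).
- by rewrite -[b _ * _ * _]mulrA -word_of_cons; apply: IH.
- by rewrite -[b _ * _ * _]mulrA -word_of_cons; apply: IH.
Qed.

(** Transvections with the same column multiply by adding their entries. The vanishing of [b_i^* X],
    which kills the cross terms, is carried through the induction. *)
Lemma G_column n (B : n.-tuple word) i (a : 'I_n -> L) : ordered_leaf_set B ->
  (forall l, is_poly (a l)) ->
  G (1 + (\sum_(l | l != i) W (tnth B l) * a l) * Ws (tnth B i)).
Proof.
move=> lB Pa; set X := \sum_(l | _) _.
suff [] : G (1 + X * Ws (tnth B i)) /\ Ws (tnth B i) * X = 0 by [].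
rewrite {}/X.
elim/big_rec: _ => [|l x li [Gx x0]].
  by rewrite mul0r mulr0 addr0; split=> //; apply: G1.
have il : Ws (tnth B i) * (W (tnth B l) * a l) = 0.
  by rewrite mulrA leaf_tuple_starM // eq_sym (negPf li) mul0r.
split; last by rewrite mulrDr il x0 addr0.
have Bli : tnth B l != tnth B i.
  by case: lB => uB _; rewrite !(tnth_nth [::]) nth_uniq ?size_tuple.
have := GM (G_transvection (s := B) lB (mem_tnth l B) (mem_tnth i B) Bli (Pa l)) Gx.
rewrite mulrDl mul1r mulrDr mulr1 !mulrA -[_ * Ws _ * x]mulrA x0 mulr0 mul0r addr0.
by rewrite mulrDl -addrA [x * _ + _]addrC.
Qed.

(** * Rows that are bases: exchange and contraction *)

Definition G_row n (p : 'I_n -> L) :=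
  forall B : n.-tuple word, ordered_leaf_set B -> G (row_sum p B).

(** The [p i] form a basis of [L] as a right module over itself, and the [q i] give the
    coordinates. *)
Definition dual_rows n (p q : 'I_n -> L) :=
  \sum_i p i * q i = 1 /\ forall i j, q i * p j = (i == j)%:R.

Lemma dual_rowsE n (p q : 'I_n -> L) u : dual_rows p q -> u = \sum_i p i * (q i * u).
Proof.
by move=> [pq _]; rewrite -[LHS]mul1r -pq mulr_suml; apply: eq_bigr => i _; rewrite mulrA.
Qed.

Lemma dual_rows_gt0 n (p q : 'I_n -> L) : dual_rows p q -> (0 < n)%N.
Proof.
by case: n p q => // p q [/eqP]; rewrite big_ord0 eq_sym oner_eq0.
Qed.

(** The leaf unit with identity matrix replaces [B] by any other leaf set of the same size. *)
Lemma G_row_any n (p q : 'I_n -> L) (B : n.-tuple word) : dual_rows p q ->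
  ordered_leaf_set B -> G (row_sum p B) -> G_row p.
Proof.
move=> pq lB Gp C lC; have -> : row_sum p C = row_sum p B * leaf_unit_of B 1%:M C.
  rewrite row_sum_leaf_unit //; apply: eq_bigr => j _; congr (_ * _).
  rewrite (bigD1 j) //= mxE eqxx scale1r big1 ?addr0 // => i /negPf ij.
  by rewrite mxE ij scale0r.
apply: GM => //; apply: Ggen => //; first exact: dual_rows_gt0 pq.
exact: unitmx1.
Qed.

Lemma G_row_step n (p p' : 'I_n -> L) i c (a : 'I_n -> L) : c != 0 ->
  (forall l, is_poly (a l)) -> (forall l, l != i -> p l = p' l) ->
  p i = c *: p' i + \sum_(l | l != i) p' l * a l -> G_row p' -> G_row p.
Proof.
(* The scaling by [c] is applied after the column operation, so the coefficients are divided by [c]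
   beforehand. *)
move=> c0 Pa pp' pi Gp' B lB; pose b l := c^-1 *: a l.
have Pb l : is_poly (b l) by apply: is_polyZ.
have Ec : (c - 1) + (c^-1 - 1) + (tnth B i == tnth B i)%:R * ((c - 1) * (c^-1 - 1)) = 0.
  by rewrite eqxx mul1r; field.
have := GM (GM (Gp' B lB) (G_column i lB Pb))
  (G_delta (s := B) lB (mem_tnth i B) (mem_tnth i B) Ec).
congr G; set X := \sum_(l | _) W _ * _; set Y := \sum_(l | l != i) p' l * b l.
have XY : row_sum p' B * X = Y.
  by rewrite mulr_sumr; apply: eq_bigr => l _; rewrite mulrA row_sum_word.
have -> : row_sum p B = row_sum p' B + (p i - p' i) * Ws (tnth B i).
  rewrite /row_sum (bigD1 i) //= [in RHS](bigD1 i) //= mulrBl addrC.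
  rewrite [RHS]addrAC [_ * _ + (_ - _)]addrC subrK addrC; congr (_ + _).
  by apply: eq_bigr => l li; rewrite pp'.
rewrite [_ * (1 + X * _)]mulrDr mulr1 mulrA XY mulrDr mulr1 -scalerAr mulrA.
rewrite [(_ + _) * W _]mulrDl row_sum_word // -[Y * _ * _]mulrA.
rewrite leaf_tuple_starM // eqxx mulr1 -addrA scalerAl -mulrDl; congr (_ + _ * _).
have -> : p i = c *: (p' i + Y).
  rewrite pi scalerDr scaler_sumr; congr (_ + _); apply: eq_bigr => l _.
  by rewrite /b -scalerAr scalerA mulfV // scale1r.
by rewrite scalerBl scale1r addrCA opprD [- p' i - Y]addrC addNKr.
Qed.

(** Solving [u = \sum_l p_l (q_l u)] for [p_i], whose coefficient is the nonzero scalar [c],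
    presents [p] as one elementary step from the new row. *)
Lemma G_row_exchange n (p q : 'I_n -> L) u i c : dual_rows p q -> c != 0 ->
  q i * u = c%:A -> (forall l, is_poly (q l * u)) ->
  G_row (fun l => if l == i then u else p l) -> G_row p.
Proof.
move=> pq c0 qiu Pq; apply: (@G_row_step _ _ _ i c^-1 (fun l => - c^-1 *: (q l * u))).
- by rewrite invr_eq0.
- by move=> l; apply: is_polyZ.
- by move=> l /negPf->.
rewrite eqxx {1}(dual_rowsE u pq) (bigD1 i) //= qiu mulr_algr scalerDr scalerA mulVf //.
rewrite scale1r -addrA scaler_sumr -big_split big1 ?addr0 // => l /negPf-> /=.
by rewrite -scalerAr -scalerDl subrr scale0r.
Qed.

Lemma dual_rows_exchange n (p q : 'I_n -> L) u i c : dual_rows p q -> c != 0 ->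
  q i * u = c%:A ->
  dual_rows (fun l => if l == i then u else p l)
    (fun l => if l == i then c^-1 *: q i else q l - c^-1 *: (q l * u * q i)).
Proof.
move=> pq c0 qiu; have [pq1 pqd] := pq; split.
  rewrite (bigD1 i) //= eqxx.
  under eq_bigr => l /negPf-> do rewrite mulrBr -scalerAr 2!mulrA.
  rewrite sumrB -scaler_sumr -mulr_suml.
  have -> : \sum_(l | l != i) p l * q l * u = u - c *: p i.
    rewrite {2}(dual_rowsE u pq) [in RHS](bigD1 i) //= qiu mulr_algr addrAC subrr add0r.
    by apply: eq_bigr => l _; rewrite mulrA.
  rewrite mulrBl scalerBr -scalerAl scalerA mulVf // scale1r -scalerAr.
  by rewrite -pq1 [in RHS](bigD1 i) //= opprB addrCA [p i * q i - _]addrC addNKr addrC.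
move=> l m /=; have [/eqP->|li] := boolP (l == i); have [/eqP->|mi] := boolP (m == i).
- by rewrite -scalerAl qiu scalerA mulVf // scale1r eqxx.
- by rewrite -scalerAl pqd eq_sym (negPf mi) scaler0.
- by rewrite (negPf li) mulrBl -scalerAl -[_ * q i * _]mulrA qiu mulr_algr scalerA mulVf // scale1r subrr.
- by rewrite mulrBl -scalerAl -[_ * q i * _]mulrA !pqd [i == m]eq_sym (negPf mi) mulr0 scaler0 subr0.
Qed.

(** The two terms combine by [v e (c e)^* + v f (c f)^* = v c^*], which uses [e e^* + f f^* = 1]. *)
Lemma G_row_contract n (p q : 'I_n.+1 -> L) v i j : dual_rows p q -> i != j ->
  p i = v * el false -> p j = v * el true ->
  G_row (fun k => if lift j k == i then v else p (lift j k)) -> G_row p.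
Proof.
move=> pq ij pi pj Gp'.
have ji : j != i by rewrite eq_sym.
have [k0 ik _] := unlift_some ji.
have n0 : (0 < n)%N by exact: leq_ltn_trans (leq0n k0) (ltn_ord k0).
have [C lC] := leaf_tuple_exists n0.
pose c := tnth C k0.
(* The position [k0] of [v] in the shorter row is expanded: [c e] goes to place [i] and [c f] to
   place [j]. *)
pose f l := if unlift j l is Some k then if k == k0 then rcons c false else tnth C k
            else rcons c true.
pose B := mktuple f.
have fj : f j = rcons c true by rewrite /f unlift_none.
have fl k : f (lift j k) = if k == k0 then rcons c false else tnth C k.
  by rewrite /f liftK.
have lB : ordered_leaf_set B.
  have [us [S lS sS]] := leaf_seq_expand_mem (s := C) lC (mem_tnth k0 C).
  have sub : {subset rcons c false :: rcons c true :: rem c C <= B}.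
    have memf l : f l \in B by rewrite -[f l](tnth_mktuple f) mem_tnth.
    move=> w; rewrite !in_cons => /or3P[/eqP->|/eqP->|].
    - by have := memf (lift j k0); rewrite fl eqxx.
    - by have := memf j; rewrite fj.
    - case: (lC) => uC _; rewrite mem_rem_uniq // inE => /andP[wc /tnthP[k wk]].
      have kk : (k == k0) = false by apply: contraNF wc => /eqP kk; rewrite wk kk.
      by have := memf (lift j k); rewrite fl kk -wk.
  have sz : (size B <= size (rcons c false :: rcons c true :: rem c C))%N.
    by rewrite size_tuple /= size_rem ?mem_tnth // size_tuple prednK.
  split; first exact: leq_size_uniq us sub sz.
  by exists S => // w; rewrite -sS; have [_ ->] := uniq_min_size us sub sz.
apply: (G_row_any pq lB); move: (Gp' C lC); congr G.
have kij k : (lift j k == i) = (k == k0).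
  by rewrite ik; apply/eqP/eqP => [/lift_inj|->].
rewrite /row_sum [RHS](bigD1_ord j) //= [in RHS](bigD1 k0) //= [LHS](bigD1 k0) //=.
rewrite kij eqxx !tnth_mktuple fj fl eqxx pj -ik pi addrA; congr (_ + _).
  rewrite -!cats1 !wordstar_of_cat !wordstar_of1 !mulrA -mulrDl -!mulrA -mulrDr.
  by rewrite [_ + _]addrC letter_relE_bool mulr1.
by apply: eq_bigr => k /negPf kk; rewrite tnth_mktuple fl kij kk.
Qed.

Lemma dual_rows_contract n (p q : 'I_n.+1 -> L) v i j : dual_rows p q -> i != j ->
  p i = v * el false -> p j = v * el true ->
  exists q', dual_rows (fun k => if lift j k == i then v else p (lift j k)) q'.
Proof.
move=> [pq1 pqd] ij pi pj.
have ji : j != i by rewrite eq_sym.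
have [k0 ik _] := unlift_some ji.
(* Indeed [v = v e e^* + v f f^* = p_i e^* + p_j f^*]; this also suggests the new coordinate
   [e q_i + f q_j]. *)
have qv l : q l * v = (l == i)%:R * st false + (l == j)%:R * st true.
  by rewrite -[LHS]mulr1 -[X in _ * X = _]letter_relE_bool mulrDr !mulrA -![_ * v * _]mulrA -pi -pj !pqd.
have kij k : (lift j k == i) = (k == k0).
  by rewrite ik; apply/eqP/eqP => [/lift_inj|->].
exists (fun k => if k == k0 then el false * q i + el true * q j
                 else q (lift j k)); split.
  rewrite -pq1 [RHS](bigD1_ord j) //= [in RHS](bigD1 k0) //= [LHS](bigD1 k0) //=.
  rewrite kij eqxx -ik pi pj mulrDr !mulrA addrA [X in X + _ = _]addrC; congr (_ + _).
  by apply: eq_bigr => k /negPf kk; rewrite kij kk.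
move=> k l; rewrite kij.
have jl m : (lift j m == j) = false by apply/negbTE; rewrite eq_sym neq_lift.
have [/eqP->|kk] := boolP (k == k0); have [/eqP->|lk] := boolP (l == k0).
- rewrite eqxx mulrDl -!mulrA !qv !eqxx (negPf ij) eq_sym (negPf ij).
  by rewrite !mul0r !mul1r addr0 add0r letter_relE_bool.
- rewrite eq_sym (negPf lk) mulrDl -!mulrA !pqd [j == _]eq_sym jl [i == _]eq_sym kij.
  by rewrite (negPf lk) !mulr0 addr0.
- by rewrite (negPf kk) qv kij (negPf kk) jl !mul0r addr0.
- by rewrite pqd (inj_eq lift_inj).
Qed.

(** * Unique splitting of polynomials by their last letter *)

Hypothesis poly_free : forall c (b : bool -> L), (forall x, is_poly (b x)) ->
  c%:A + \sum_x b x * E x = 0 -> c = 0 /\ forall x, b x = 0.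

Lemma poly_split_inj c c' (b b' : bool -> L) :
  (forall x, is_poly (b x)) -> (forall x, is_poly (b' x)) ->
  c%:A + \sum_x b x * E x = c'%:A + \sum_x b' x * E x ->
  c = c' /\ forall x, b x = b' x.
Proof.
move=> Pb Pb' /eqP; rewrite -subr_eq0 opprD addrACA -scalerBl -sumrB.
under eq_bigr do rewrite -mulrBl.
move=> /eqP /poly_free[x|/eqP+ b0]; first exact: is_polyB.
by rewrite subr_eq0 => /eqP; split=> // x; apply/eqP; rewrite -subr_eq0 b0.
Qed.

Hypothesis poly_long_words : forall a,
  exists N, forall w, (N <= size w)%N -> is_poly (a * W w).

Lemma poly_lt_is_poly k a : poly_lt k a -> is_poly a.
Proof. by exists k. Qed.

Lemma is_polyM a b : is_poly a -> is_poly b -> is_poly (a * b).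
Proof.
move=> Pa [k]; elim: k b => [|k IH] b /=; first by move=> ->; rewrite mulr0; exists 0%N.
move=> [c [f [-> Pf]]]; rewrite mulrDr mulr_algr mulr_sumr.
apply: is_polyD; first exact: is_polyZ.
by apply: is_poly_sum => x _; rewrite mulrA; apply/is_poly_letter/IH.
Qed.

Lemma poly_lt1P a : poly_lt 1 a -> exists c, a = c%:A.
Proof.
move=> [c [b [-> b0]]]; exists c; rewrite big1 ?addr0 // => x _.
by rewrite (b0 x) mul0r.
Qed.

(* A Leibniz rule: stripping the final letter [x] from [\sum_i p_i c_i] strips it from
   the [c_i], up to a remainder coming from the constant terms of the [c_i]. *)
Lemma poly_split_sum n (p : 'I_n -> L) (d : 'I_n -> nat) (a : 'I_n -> K)
    (b : 'I_n -> bool -> L) (c : K) (t : bool -> L) k :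
  (forall i, poly_lt (d i) (p i)) -> (forall i, a i != 0 -> (d i <= k)%N) ->
  (forall i x, is_poly (b i x)) -> (forall x, is_poly (t x)) ->
  \sum_i p i * ((a i)%:A + \sum_x b i x * E x) = c%:A + \sum_x t x * E x ->
  forall x, exists2 r, poly_lt k.-1 r & t x = \sum_i p i * b i x + r.
Proof.
move=> Pp ak Pb Pt.
have /fin_all_exists[pc /fin_all_exists[pd pE]] i := poly_lt_split (Pp i).
(* Only terms with [a i != 0] contribute, and for them [d i <= k]; this bounds the remainder. *)
pose r x := \sum_i a i *: pd i x.
have Pr x : poly_lt k.-1 (r x).
  apply: poly_lt_sum => i _; have [->|/ak dk] := eqVneq (a i) 0.
    by rewrite scale0r; apply: poly_lt0.
  by apply: poly_ltZ; case: (pE i) => _ Pd _; apply: poly_ltW (Pd x); lia.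
have -> : \sum_i p i * ((a i)%:A + \sum_x b i x * E x) =
    (\sum_i a i * pc i)%:A + \sum_x (\sum_i p i * b i x + r x) * E x.
  have step i : p i * ((a i)%:A + \sum_x b i x * E x) =
      (a i * pc i)%:A + \sum_x (p i * b i x + a i *: pd i x) * E x.
    rewrite mulrDr mulr_algr mulr_sumr; case: (pE i) => {1}-> _ _.
    rewrite scalerDr scalerA scaler_sumr -addrA -big_split; congr (_ + _).
    by apply: eq_bigr => x _; rewrite mulrDl mulrA addrC scalerAl.
  rewrite (eq_bigr _ (fun i _ => step i)) big_split scaler_suml; congr (_ + _).
  by rewrite exchange_big; apply: eq_bigr => x _; rewrite -big_split mulr_suml.
move=> eqs x; exists (r x) => //.
have [||_ ->] := poly_split_inj _ _ eqs => // y.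
apply: is_polyD; last exact: poly_lt_is_poly (Pr y).
by apply: is_poly_sum => i _; apply: is_polyM (poly_lt_is_poly (Pp i)) (Pb i y).
Qed.

(** * The weak algorithm for reduced rows *)

(* No entry [p_i] can be replaced by [p_i + \sum_(j != i) p_j c_j] of lower degree. *)
Definition reduced n (p : 'I_n -> L) (d : 'I_n -> nat) :=
  forall i (c : 'I_n -> L), (forall j, is_poly (c j)) -> c i = 1 ->
    ~ poly_lt (d i).-1 (\sum_j p j * c j).

Section Reduced.
Variables (n : nat) (p : 'I_n -> L) (d : 'I_n -> nat).
Hypothesis Pp : forall i, poly_lt (d i) (p i).
Hypothesis d_gt0 : forall i, (0 < d i)%N.
Hypothesis pd : reduced p d.

(** The hypotheses allow terms of degree up to [k - 1], with this top degree cancelling in the sum;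
    then it is absent from every term. The induction strips last letters. *)
Lemma reduced_step k (c : 'I_n -> L) :
  (forall i, poly_lt (k.+1 - d i) (c i)) -> poly_lt k.-1 (\sum_i p i * c i) ->
  forall i, poly_lt (k - d i) (c i).
Proof.
elim: k c => [|k IH] c Pc Ps i.
  by have := Pc i; rewrite (_ : 1 - d i = 0 - d i)%N //; have := d_gt0 i; lia.
have /fin_all_exists[a /fin_all_exists[b cE]] j := poly_lt_split (Pc j).
have a_d j : a j != 0 -> (d j <= k.+1)%N.
  by move=> aj; rewrite leqNgt; apply: contraNN aj => dj; apply/eqP; case: (cE j) => _ _; apply; lia.
(* If such a [j] exists, [c j] is a nonzero constant; dividing by it makes the cancellation
   contradict [reduced]. *)
have [/existsP[j /andP[/eqP dj aj]]|/existsPn nex] := boolP [exists j, (d j == k.+1) && (a j != 0)].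
  have cj : c j = (a j)%:A.
    case: (cE j) => -> Pb _; rewrite big1 ?addr0 // => x _.
    by have := Pb x; rewrite dj (_ : (k.+2 - k.+1).-1 = 0)%N => [->|]; [rewrite mul0r | lia].
  case: (pd (i := j) (c := fun l => (a j)^-1 *: c l)).
  - by move=> l; apply/is_polyZ/poly_lt_is_poly/Pc.
  - by rewrite cj scalerA mulVf // scale1r.
  - rewrite dj; under eq_bigr do rewrite -scalerAr.
    by rewrite -scaler_sumr; apply: poly_ltZ.
have a_k j : a j != 0 -> (d j <= k)%N.
  by move=> aj; have := nex j; rewrite aj andbT; have := a_d _ aj; lia.
have [s0 [t [sE Pt _]]] := poly_lt_split Ps.
have bE : forall x, exists2 r, poly_lt k.-1 r & t x = \sum_l p l * b l x + r.
  apply: (poly_split_sum (c := s0) Pp a_k) => [l x|x|].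
  - by case: (cE l) => _ Pb _; apply: poly_lt_is_poly (Pb x).
  - exact: poly_lt_is_poly (Pt x).
  - by rewrite -sE; apply: eq_bigr => l _; case: (cE l) => ->.
have Pb x j : poly_lt (k - d j) (b j x).
  apply: (IH (fun l => b l x)) => [l|].
    by case: (cE l) => _ /(_ x); rewrite (_ : (k.+2 - d l).-1 = k.+1 - d l)%N; last lia.
  have [r Pr tx] := bE x.
  have -> : \sum_l p l * b l x = t x - r by rewrite tx addrK.
  by apply: poly_ltD (Pt x) (poly_ltN Pr).
have [dk|kd] := leqP (d i) k.
  by rewrite subSn //; case: (cE i) => -> _ _; exists (a i), (b i).
have ai : a i = 0 by apply/eqP; apply: contraTT kd => /a_k; rewrite leqNgt.
case: (cE i) => -> _ _; rewrite ai scale0r add0r big1 => [|x _]; first exact: poly_lt0.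
by have := Pb x i; rewrite (_ : k - d i = 0)%N => [->|]; [rewrite mul0r | lia].
Qed.

(** From a crude common bound with excess [t], [reduced_step] lowers the excess one degree at a
    time. *)
Lemma reduced_bound m (c : 'I_n -> L) :
  (forall i, is_poly (c i)) -> poly_lt m (\sum_i p i * c i) ->
  forall i, poly_lt (m.+1 - d i) (c i).
Proof.
move=> /fin_all_exists[N PN] Ps.
have : exists t, forall i, poly_lt ((m + t).+1 - d i) (c i).
  exists (\sum_i N i + \sum_i d i)%N => i; apply: poly_ltW (PN i).
  by rewrite (bigD1 i) // (bigD1 (F := d) i) //=; lia.
move=> [t]; elim: t => [|t IH] Pc; first by move: Pc; rewrite addn0.
apply: IH; apply: (@reduced_step (m + t).+1); first by rewrite -addnS.
by apply: poly_ltW Ps; rewrite leq_addr.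
Qed.

End Reduced.

(** * Descent from a polynomial row to a scalar *)

Lemma G_row_scalar (p q : 'I_1 -> L) a : dual_rows p q -> a != 0 -> p ord0 = a%:A -> G_row p.
Proof.
move=> pq a0 pa; have l1 := leaf_seq_nil.
apply: (@G_row_any _ _ _ [tuple [::]] pq l1).
rewrite /row_sum big_ord1 pa (tnth_nth [::]) wordstar_of_nil mulr1.
have := G_delta (k := a - 1) (k' := a^-1 - 1) l1 (mem_head _ _) (mem_head _ _).
rewrite eqxx mul1r wordstar_of_nil word_of_nil mulr1 -[X in X + (a - 1)%:A]scale1r -scalerDl.
by rewrite [1 + _]addrC subrK; apply; field.
Qed.

Lemma dual_rows_neq0 n (p q : 'I_n -> L) i : dual_rows p q -> p i != 0 /\ q i != 0.
Proof.
move=> [_ pqd]; have := pqd i i; rewrite eqxx => qp.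
by split; apply: contra_eqN qp => /eqP->; rewrite ?mul0r ?mulr0 eq_sym oner_neq0.
Qed.

(* As [a = \sum_i p_i (q_i a)], this says that [a] lies in the right ideal generated by
   the [p_i] in the algebra of polynomials. *)
Definition right_poly n (q : 'I_n -> L) (a : L) := forall i, is_poly (q i * a).

(** Otherwise every word outside the ideal has a one-letter extension outside it, giving such words
    of every length, while all long words lie inside. *)
Lemma right_poly_socle n (q : 'I_n -> L) : ~ right_poly q 1 ->
  exists2 v, is_poly v & ~ right_poly q v /\ forall x, right_poly q (v * E x).
Proof.
move=> q1; apply: contrapT => nex.
have long N : exists2 w, size w = N & ~ right_poly q (W w).
  elim: N => [|N [w wN qw]]; first by exists [::]; rewrite ?word_of_nil.
  apply: contrapT => nex'; apply: nex; exists (W w); first exact: is_poly_word.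
  split=> // x; apply: contrapT => qwx; apply: nex'.
  by exists (rcons w x); rewrite ?size_rcons ?wN // -cats1 word_of_cat word_of1.
have /fin_all_exists[N PN] i := poly_long_words (q i).
have [w wN []] := long (\sum_i N i)%N; move=> i; apply: PN.
by rewrite wN (bigD1 i) //= leq_addr.
Qed.

Section Pivots.
Variables (n : nat) (p q : 'I_n.+1 -> L) (d : 'I_n.+1 -> nat) (v : L) (k : nat).
Hypothesis pq : dual_rows p q.
Hypothesis Pp : forall i, poly_lt (d i) (p i).
Hypothesis d_gt0 : forall i, (0 < d i)%N.
Hypothesis pd : reduced p d.
Hypothesis Pv : poly_lt k v.
Hypothesis qv : ~ right_poly q v.
Hypothesis qvE : forall x, right_poly q (v * E x).
Hypothesis k_min : forall r, poly_lt k.-1 r -> (forall x, right_poly q (r * E x)) ->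
  right_poly q r.

Lemma socle_bound i x : poly_lt (k.+2 - d i) (q i * (v * E x)).
Proof.
apply: (reduced_bound Pp d_gt0 pd (m := k.+1) (c := fun i => q i * (v * E x))).
  by move=> j; apply: qvE.
by rewrite -(dual_rowsE _ pq); apply: poly_lt_letter.
Qed.

(** Otherwise only entries with [d i <= k] occur in [\sum_x lam x v x]. Stripping [x0] writes
    [lam x0 v] as an element of the ideal plus some [r] of smaller degree, and minimality puts [r],
    hence [v], into the ideal. *)
Lemma socle_indep (lam : bool -> K) : (exists x, lam x != 0) ->
  exists2 i, d i = k.+1 & \sum_x lam x *: (q i * (v * E x)) != 0.
Proof.
move=> [x0 lam0]; apply: contrapT => nex.
pose c i := \sum_x lam x *: (q i * (v * E x)).
(* The value 0 encodes vanishing: at [d i = k.+1] by the negated conclusion, beyond it by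
   [socle_bound]. *)
pose m i := if (d i <= k)%N then (k.+2 - d i)%N else 0%N.
have Pc i : poly_lt (m i) (c i).
  have Pc : poly_lt (k.+2 - d i) (c i).
    by apply: poly_lt_sum => x _; apply/poly_ltZ/socle_bound.
  rewrite /m; case: leqP => // dk; move: dk; rewrite leq_eqVlt => /orP[/eqP dk|dk].
    by apply/eqP; apply: contraT => ci; case: nex; exists i.
  by move: Pc; rewrite (_ : k.+2 - d i = 0)%N //; lia.
have /fin_all_exists[a /fin_all_exists[b cE]] j := poly_lt_split (Pc j).
have a_k j : a j != 0 -> (d j <= k)%N.
  move=> aj; apply: contraNT aj => dj; apply/eqP; case: (cE j) => _ _; apply.
  by rewrite /m (negPf dj).
have [r Pr tx] : exists2 r, poly_lt k.-1 r & lam x0 *: v = \sum_l p l * b l x0 + r.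
  move: x0 {lam0}; apply: (poly_split_sum (c := 0) (t := fun x => lam x *: v) Pp a_k).
  - by move=> i x; case: (cE i) => _ Pb _; apply: poly_lt_is_poly (Pb x).
  - by move=> x; apply: poly_lt_is_poly (poly_ltZ _ Pv).
  transitivity (\sum_i p i * c i).
    by apply: eq_bigr => i _; case: (cE i) => ->.
  rewrite scale0r add0r (dual_rowsE (\sum_x lam x *: v * E x) pq).
  apply: eq_bigr => i _; congr (_ * _); rewrite mulr_sumr; apply: eq_bigr => x _.
  by rewrite -scalerAl scalerAr.
have qr j : q j * r = lam x0 *: (q j * v) - b j x0.
  rewrite scalerAr tx mulrDr mulr_sumr (bigD1 j) //= mulrA; have [_ pqd] := pq.
  rewrite pqd eqxx mul1r big1 => [|l /negPf lj]; last by rewrite mulrA pqd eq_sym lj mul0r.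
  by rewrite addr0 addrAC subrr add0r.
have Pb j : is_poly (b j x0) by case: (cE j) => _ Pb _; apply: poly_lt_is_poly (Pb x0).
have Rr : right_poly q r.
  apply: (k_min Pr) => x j; rewrite mulrA qr mulrBl -scalerAl -mulrA.
  by apply: is_polyB; [apply/is_polyZ/qvE | apply: is_poly_letter].
apply: qv => j; have -> : q j * v = (lam x0)^-1 *: (q j * r + b j x0).
  by rewrite qr subrK scalerA mulVf // scale1r.
by apply/is_polyZ/is_polyD.
Qed.

Lemma socle_const i x : d i = k.+1 -> exists c, q i * (v * E x) = c%:A.
Proof.
move=> di; apply: poly_lt1P; have := socle_bound i x.
by rewrite di subSS subSnn.
Qed.

(* Two exchanges bring [v e] and [v f] into the row, which then contracts to [v]. *)
Lemma G_row_socle :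
  (forall p' q' : 'I_n -> L, dual_rows p' q' -> (forall i, is_poly (p' i)) -> G_row p') ->
  G_row p.
Proof.
move=> IH.
have [|i di] := @socle_indep (fun x => (x == false)%:R).
  by exists false; rewrite oner_neq0.
rewrite big_bool /= scale0r add0r scale1r.
have [[al alE] [be beE]] := (socle_const false di, socle_const true di).
rewrite alE scaler_eq0 oner_eq0 orbF => al0.
(* This combination is the coordinate of [v f] at [j] after the first exchange, so its nonvanishing
   supplies the second pivot. *)
have [|j dj] := @socle_indep (fun x => if x then 1 else - (al^-1 * be)).
  by exists true; rewrite oner_neq0.
rewrite big_bool /= scale1r.
have [[ga gaE] [de deE]] := (socle_const false dj, socle_const true dj).
rewrite gaE deE scalerA -scalerDl scaler_eq0 oner_eq0 orbF => th0.
(* At [i] the same combination is [be - al^-1 be al = 0]. *)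
have ij : i != j.
  apply: contraNneq th0 => ij; have inj1 : injective (fun c : K => c%:A : L).
    by move=> c c' /eqP; rewrite -subr_eq0 -scalerBl scaler_eq0 oner_eq0 orbF subr_eq0 => /eqP.
  have -> : ga = al by apply: inj1; rewrite -gaE -ij.
  have -> : de = be by apply: inj1; rewrite -deE -ij.
  by apply/eqP; field.
pose p1 l := if l == i then v * E false else p l.
pose q1 l := if l == i then al^-1 *: q i else q l - al^-1 *: (q l * (v * E false) * q i).
have pq1 : dual_rows p1 q1 by apply: dual_rows_exchange.
apply: (G_row_exchange pq al0 alE (fun l => qvE false l)).
have q1i : q1 i * (v * E true) = (al^-1 * be)%:A by rewrite /q1 eqxx -scalerAl beE scalerA.
have q1l l : l != i -> q1 l * (v * E true) =
    q l * (v * E true) - (al^-1 * be) *: (q l * (v * E false)).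
  move=> /negPf li; rewrite /q1 li mulrBl -scalerAl -[_ * q i * _]mulrA beE mulr_algr.
  by rewrite scalerA.
have q1j : q1 j * (v * E true) = (de + - (al^-1 * be) * ga)%:A.
  by rewrite q1l 1?eq_sym // deE gaE scalerA scalerDl mulNr scaleNr.
have Pv1 x : is_poly (v * E x) by apply/is_poly_letter/poly_lt_is_poly/Pv.
have Pq1 l : is_poly (q1 l * (v * E true)).
  have [->|li] := eqVneq l i; first by rewrite q1i; apply: is_polyC.
  by rewrite q1l //; apply: is_polyB; [|apply: is_polyZ]; apply: qvE.
have pq2 := dual_rows_exchange pq1 th0 q1j.
apply: (G_row_exchange pq1 th0 q1j Pq1).
have p2i : (if i == j then v * E true else p1 i) = v * E false.
  by rewrite (negPf ij) /p1 eqxx.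
have p2j : (if j == j then v * E true else p1 j) = v * E true by rewrite eqxx.
have [q3 pq3] := dual_rows_contract pq2 ij p2i p2j.
apply: (G_row_contract pq2 ij p2i p2j); apply: IH pq3 _ => l.
case: ifP => _; first exact: poly_lt_is_poly Pv.
by rewrite /p1; do 2?case: ifP => _ //; apply: poly_lt_is_poly (Pp _).
Qed.

End Pivots.

(** The outer induction is on the length, lowered by contraction; the inner one is on the sum of the
    degree bounds, lowered by exchange while the row is not reduced. *)
Lemma G_row_poly n (p q : 'I_n -> L) : dual_rows p q -> (forall i, is_poly (p i)) -> G_row p.
Proof.
elim: n p q => [|n IHn] p q pq; first by have := dual_rows_gt0 pq.
move=> /fin_all_exists[d Pp].
have [D] := ubnP (\sum_i d i); elim: D => // D IHD in p q d pq Pp *; rewrite ltnS => dD.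
have d_gt0 i : (0 < d i)%N.
  rewrite lt0n; apply/eqP => di; have := Pp i; rewrite di => /eqP.
  by have [/negPf->] := dual_rows_neq0 i pq.
have [_ pqd] := pq.
have [pd|npd] := pselect (reduced p d); last first.
  (* A combination refuting [reduced] has coefficient 1 at [i], so it can replace [p i]. *)
  apply: contrapT => nG; apply: npd => i c Pc ci Pu; apply: nG.
  pose u := \sum_j p j * c j.
  have qu l : q l * u = c l.
    rewrite mulr_sumr (bigD1 l) //= mulrA pqd eqxx mul1r big1 ?addr0 // => m /negPf ml.
    by rewrite mulrA pqd eq_sym ml mul0r.
  have qui : q i * u = 1%:A by rewrite qu ci scale1r.
  apply: (G_row_exchange pq (oner_neq0 K) qui) => [l|]; first by rewrite qu.
  apply: IHD (dual_rows_exchange pq (oner_neq0 K) qui)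
    (_ : forall l, poly_lt (if l == i then (d i).-1 else d l) _) _.
    by move=> l; case: ifP.
  apply: leq_trans dD; rewrite (bigD1 i) // [ltnRHS](bigD1 i) //= eqxx.
  rewrite -addSn prednK // leq_add2l; apply: eq_leq; apply: eq_bigr => l /negPf->.
  by [].
(* If 1 lies in the ideal, the degree bound on [q] makes [p ord0] a nonzero scalar; a further entry
   would have [q ord_max = 0]. *)
have [q_poly|q_npoly] := pselect (right_poly q 1).
  have Pq i : poly_lt (2 - d i) (q i).
    apply: (reduced_bound Pp d_gt0 pd) => [j|]; first by have := q_poly j; rewrite mulr1.
    by have [-> _] := pq; rewrite -[1]scale1r; apply: poly_ltC.
  have [p0 /eqP q0] := dual_rows_neq0 ord0 pq.
  have d0 : d ord0 = 1%N.
    apply/eqP; rewrite eqn_leq d_gt0 andbT leqNgt; apply/negP => d0; apply: q0.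
    by have := Pq ord0; rewrite (_ : 2 - d ord0 = 0)%N //; apply/eqP; rewrite subn_eq0.
  have := Pp ord0; rewrite d0 => /poly_lt1P[a p0E].
  have a0 : a != 0 by apply: contraNneq p0 => a0; rewrite p0E a0 scale0r.
  case: n => [|n] in p q pq p0E p0 q0 pqd {IHn IHD d0 q_poly Pq d dD Pp d_gt0 pd} *.
    exact: G_row_scalar pq a0 p0E.
  have [_ /eqP[]] := dual_rows_neq0 ord_max pq.
  have := pqd ord_max ord0; rewrite p0E mulr_algr => /eqP.
  by rewrite scaler_eq0 (negPf a0) => /eqP.
have [v [k0 Pv] [qv qvE]] := right_poly_socle q_npoly.
have : exists k, `[< exists v, [/\ poly_lt k v, ~ right_poly q v &
    forall x, right_poly q (v * E x)] >] by exists k0; apply/asboolP; exists v.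
move=> /ex_minnP[k /asboolP[w [Pw qw qwE]] k_min].
apply: (G_row_socle pq Pp d_gt0 pd Pw qw qwE) => [r Pr qrE|]; last exact: IHn.
apply: contrapT => qr; have k_gt0 : (0 < k)%N.
  rewrite lt0n; apply/eqP => k00; apply: qw; move: Pw; rewrite k00 => -> i.
  by rewrite mulr0; exists 0%N.
have : (k <= k.-1)%N by apply: k_min; apply/asboolP; exists r.
by rewrite leqNgt ltn_predL k_gt0.
Qed.

(** Over a leaf set of long enough words the entries [x a] are polynomials, with dual row
    [a^* y]. *)
Lemma G_of_inverse (x y : L) : y * x = 1 -> x * y = 1 -> G x.
Proof.
move=> yx xy; have [N PN] := poly_long_words x; have [s ls sN] := leaf_seq_long N.
pose A := in_tuple s; have lA : ordered_leaf_set A := ls.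
pose p i := x * W (tnth A i).
have <- : row_sum p A = x.
  rewrite -[RHS]mulr1 -(leaf_tuple_sum lA) mulr_sumr.
  by apply: eq_bigr => i _; rewrite mulrA.
suff pq : dual_rows p (fun i => Ws (tnth A i) * y).
  by apply: G_row_poly pq _ _ lA => i; apply/PN/sN/mem_tnth.
split=> [|i j].
  rewrite -xy -[y in RHS]mul1r -(leaf_tuple_sum lA) mulr_suml mulr_sumr.
  by apply: eq_bigr => i _; rewrite !mulrA.
by rewrite mulrA -[_ * y * x]mulrA yx mulr1 leaf_tuple_starM.
Qed.

End LeavittFamily.

(** * The Leavitt algebra *)

Section LeavittUnits.
Variable K : fieldType.
Local Notation L := (leavitt K).
Local Notation E x := (letter_elt K x).
Local Notation poly_lt := (poly_lt (letter_elt K)).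
Local Notation is_poly := (is_poly (letter_elt K)).

Lemma letter_starEsum : \sum_x E x * letter_star K x = 1.
Proof. by rewrite big_bool /= addrC letter_starE. Qed.

(** * Linear independence of words through the action *)

(* The words acting on the unit vector at [m] give distinct unit vectors, at the
   integers whose binary expansion extends that of [m]. *)
Definition unit_vec m : nat -> K := fun n => (n == m)%:R.

Lemma leavitt_act_unit_vec x m :
  leavitt_act (E x) (unit_vec m) = unit_vec (x + m.*2)%N.
Proof.
rewrite leavitt_act_letter; apply/funext => n /=; rewrite /unit_vec.
case: eqP => [<-|nx].
  by congr (_%:R); congr (nat_of_bool _); apply/eqP/eqP; lia.
by case: eqP => // n_eq; case: nx; move: n_eq; case: x => ->; lia.
Qed.

Lemma leavitt_act_split c (b : bool -> L) m n :
  leavitt_act (c%:A + \sum_x b x * E x) (unit_vec m) n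
    = c * unit_vec m n + \sum_x leavitt_act (b x) (unit_vec (x + m.*2)%N) n.
Proof.
have step x : leavitt_act (b x * E x) (unit_vec m) n
    = leavitt_act (b x) (unit_vec (x + m.*2)%N) n.
  by rewrite leavitt_actM leavitt_act_unit_vec.
rewrite leavitt_actD leavitt_actZ leavitt_act1 !big_bool leavitt_actD.
by congr (_ + (_ + _)); apply: step.
Qed.

Lemma poly_act_supp k a m n :
  poly_lt k a -> leavitt_act a (unit_vec m) n != 0 -> exists j, (n %/ 2 ^ j)%N = m.
Proof.
elim: k a m => [|k IH] a m /=.
  by move=> ->; rewrite -(scale0r 1) leavitt_actZ mul0r eqxx.
move=> [c [b [-> Pb]]]; rewrite leavitt_act_split.
have [<- _|n_m] := eqVneq n m; first by exists 0%N; rewrite expn0 divn1.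
rewrite /unit_vec (negPf n_m) mulr0 add0r -/(unit_vec _).
have [/existsP[x x0]|/existsPn b0] := boolP
  [exists x : bool, leavitt_act (b x) (unit_vec (x + m.*2)%N) n != 0].
  have [j jE] := IH _ _ (Pb x) x0.
  by exists j.+1; rewrite expnSr divnMA jE; case: x {x0 jE} => /=; lia.
by rewrite big1 ?eqxx // => x _; apply/eqP; have := b0 x; rewrite negbK.
Qed.

(** The three parts have disjoint supports: [m] itself and the binary extensions of [2m] and of
    [2m + 1]. Positivity of [m] excludes leading zeros, which would identify extensions of different
    lengths. *)
Lemma act_split_eq0 c (b : bool -> L) m : (0 < m)%N -> (forall x, is_poly (b x)) ->
  (forall n, leavitt_act (c%:A + \sum_x b x * E x) (unit_vec m) n = 0) ->
  c = 0 /\ forall (x : bool) n, leavitt_act (b x) (unit_vec (x + m.*2)%N) n = 0.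
Proof.
move=> m0 Pb a0.
have low (x : bool) n : (n < x + m.*2)%N -> leavitt_act (b x) (unit_vec (x + m.*2)%N) n = 0.
  move=> lt_n; apply/eqP; apply: contraLR lt_n => nz; have [k Pk] := Pb x.
  by have [j <-] := poly_act_supp Pk nz; rewrite -leqNgt leq_div.
have c0 : c = 0.
  have := a0 m; rewrite leavitt_act_split big1 => [|x _]; last by apply: low; lia.
  by rewrite /unit_vec eqxx mulr1 addr0.
split=> // x n; apply/eqP; apply: contraT => nz.
have := a0 n; rewrite leavitt_act_split c0 mul0r add0r (bigD1 x) //=.
rewrite (big_pred1 (~~ x)); last by case: x {nz}; case.
move=> /eqP; rewrite addr_eq0 => /eqP e.
have nz' : leavitt_act (b (~~ x)) (unit_vec (~~ x + m.*2)%N) n != 0.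
  by rewrite -oppr_eq0 -e.
have [k Pk] := Pb x; have [j jE] := poly_act_supp Pk nz.
have [k' Pk'] := Pb (~~ x); have [j' jE'] := poly_act_supp Pk' nz'.
(* Deleting further digits from [y + 2m] leaves at most [m], which is below [y' + 2m]. *)
have lt_absurd (i i' : nat) (y y' : bool) : (i < i')%N -> (n %/ 2 ^ i)%N = (y + m.*2)%N ->
    (n %/ 2 ^ i')%N = (y' + m.*2)%N -> false.
  move=> ii' e1; rewrite -(subnKC ii') expnD divnMA expnSr divnMA e1.
  have : ((y + m.*2) %/ 2 %/ 2 ^ (i' - i.+1) <= m)%N.
    by apply: leq_trans (leq_div _ _) _; case: y {e1}; lia.
  by move=> ? e2; case: y' e2; lia.
have [jj'|j'j|jj'] := ltngtP j j'.
- exact: lt_absurd jj' jE jE'.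
- exact: lt_absurd j'j jE' jE.
- by move: jE'; rewrite -jj' jE; case: x {nz nz' Pk Pk' jE e}; lia.
Qed.

Lemma poly_act_inj k a m : (0 < m)%N -> poly_lt k a ->
  (forall n, leavitt_act a (unit_vec m) n = 0) -> a = 0.
Proof.
elim: k a m => [|k IH] a m m0 //= [c [b [-> Pb]]] a0.
have [|-> b0] := act_split_eq0 m0 _ a0; first by move=> x; exists k.
rewrite scale0r add0r big1 // => x _.
by rewrite (IH _ (x + m.*2)%N _ (Pb x)) ?mul0r //; lia.
Qed.

Lemma leavitt_poly_free c (b : bool -> L) : (forall x, is_poly (b x)) ->
  c%:A + \sum_x b x * E x = 0 -> c = 0 /\ forall x, b x = 0.
Proof.
move=> Pb a0; have [n|-> b0] := @act_split_eq0 c b 1 isT Pb.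
  by rewrite a0 -(scale0r 1) leavitt_actZ mul0r.
split=> // x; have [k Pk] := Pb x.
by apply: poly_act_inj Pk (b0 x); lia.
Qed.

(** Each starred letter costs one more letter of [w]: its last letter is kept aside for
    [is_poly_star]. *)
Lemma leavitt_long_words (a : L) :
  exists N, forall w, (N <= size w)%N -> is_poly (a * word_of (letter_elt K) w).
Proof.
elim/leavitt_ind: a => [|a b [M Pa] [N Pb]|c a [N Pa]|x a [N Pa]|x a [N Pa]].
- by exists 0%N => w _; rewrite mul1r; apply: is_poly_word.
- exists (maxn M N) => w; rewrite geq_max => /andP[Mw Nw].
  by rewrite mulrDl; apply: is_polyD; auto.
- by exists N => w Nw; rewrite -scalerAl; apply: is_polyZ; auto.
- exists N => w Nw; rewrite -mulrA -(word_of1 (letter_elt K)).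
  by apply: is_polyM (Pa w Nw); apply: is_poly_word.
- exists N.+1 => w; case: (lastP w) => // v y; rewrite size_rcons ltnS => Nv.
  rewrite -cats1 word_of_cat -mulrA [a * _]mulrA mulrA.
  by apply: (is_poly_star (@letter_starM K)); apply: Pa.
Qed.

End LeavittUnits.

Lemma unitr_mul (R : unitRingType) (x y : R) :
  x \is a GRing.unit -> y \is a GRing.unit -> x * y \is a GRing.unit.
Proof. by move=> ux uy; rewrite unitrMr. Qed.

Theorem theorem4p3 (K : fieldType) (x : leavitt K) :
  LGL2 x <-> x \is a GRing.unit.
Proof.
split=> [|/unitrP[y [yx xy]]].
  elim=> {x} [n A B M _ lA lB uM||x y _ ux _ uy|x _ ux].
  - apply/unitrP; exists (leaf_unit B (invmx M) A).
    exact: (leaf_unitV (@letter_starM K) (letter_starEsum K) lA lB uM).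
  - exact: unitr1.
  - exact: unitr_mul ux uy.
  - by rewrite unitrV.
apply: (G_of_inverse (@letter_starM K) (letter_starEsum K) (@LGL2_1 K) (@LGL2_M K)
  (@LGL2_gen K) (@leavitt_poly_free K) (@leavitt_long_words K) yx xy).
Qed.
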